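(* Let $k$ be an algebraically closed field and let $X$ be an irreducible and reduced projective variety of dimension $r$ over $k$. Let $n\geq r+2$. Then any two birational embeddings $\mathcal{L}$ and $\mathcal{G}$ of $X$ in $\mathbb{P}^n$ are Cremona equivalent; that is, there exists a birational map $\Phi:\mathbb{P}^n\dashrightarrow\mathbb{P}^n$, defined on the general point of $\varphi_{\mathcal{G}}(X)$, such that $\varphi_{\mathcal{L}}=\Phi\circ\varphi_{\mathcal{G}}$ as rational maps on $X$.
   Context: A linear system $\mathcal{L}$ on $X$ generated by $\{L_0,\ldots,L_n\}$ (sections, not all zero, in which the generators need not be linearly independent, some may be zero, and the system need not be complete) determines a rational map $\varphi_{\mathcal{L}}:X\dashrightarrow\mathbb{P}^n$, $x\mapsto[L_0(x),\ldots,L_n(x)]$. The system $\mathcal{L}$ is called a birational embedding of $X$ in $\mathbb{P}^n$ if $\varphi_{\mathcal{L}}$ is birational onto its image; here $\varphi_{\mathcal{L}}(X)$ denotes the closure of the image. Two such maps are regarded as equal, $\varphi_{\mathcal{L}}=\varphi_{\mathcal{M}}$, if there is a dense open subset $U\subset X$ on which both are defined and have equal restriction. Two birational embeddings $\mathcal{L},\mathcal{G}$ in $\mathbb{P}^n$ are Cremona equivalent if there is a birational map $\Phi:\mathbb{P}^n\dashrightarrow\mathbb{P}^n$, defined on the general point of $\varphi_{\mathcal{G}}(X)$, with $\varphi_{\mathcal{L}}=\Phi\circ\varphi_{\mathcal{G}}$. Such a $\Phi$ need not be regular. *)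

(* Defs.v *)
From mathcomp Require Import all_boot all_order all_algebra.
From mathcomp.multinomials Require Import mpoly.

Set Implicit Arguments.
Unset Strict Implicit.
Unset Printing Implicit Defensive.

Import GRing.Theory.
Local Open Scope ring_scope.

(* Classical projective geometry over an algebraically closed field k.        *)
(* A point of P^n is represented by any of its vectors of homogeneous         *)
(* coordinates, a nonzero row of length n.+1; two such rows are the same      *)
(* point when they are related by [same_pt].  Subsets of P^n and graphs of    *)
(* partial maps are predicates on these representatives.  An (irreducible,    *)
(* reduced) projective variety is an irreducible closed subset of some P^N.   *)

Section ProjectiveGeometry.
Variable k : closedFieldType.

Definition same_pt n (x y : 'rV[k]_n.+1) : Prop :=
  [/\ x != 0, y != 0 & exists c : k, y = c *: x].

Definition pset n := 'rV[k]_n.+1 -> Prop.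

Definition pspace n : pset n := fun x => x != 0.

Definition zclosed n (Z : pset n) : Prop :=
  exists S : {mpoly k[n.+1]} -> Prop,
    (forall p, S p -> exists d, p \is d.-homog) /\
    (forall x, Z x <-> x != 0 /\ forall p, S p -> p.@[x 0] = 0).

Definition zclosure n (A : pset n) : pset n :=
  fun x => forall Z, zclosed Z -> (forall y, A y -> Z y) -> Z x.

Definition zopen_in n (X U : pset n) : Prop :=
  exists2 Z, zclosed Z & forall x, U x <-> X x /\ ~ Z x.

Definition dense_open n (X U : pset n) : Prop :=
  zopen_in X U /\ forall x, X x -> zclosure U x.

Definition zirreducible n (X : pset n) : Prop :=
  (exists x, X x) /\
  forall Z1 Z2, zclosed Z1 -> zclosed Z2 ->
    (forall x, X x -> Z1 x \/ Z2 x) ->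
    (forall x, X x -> Z1 x) \/ (forall x, X x -> Z2 x).

Definition projective_variety n (X : pset n) : Prop :=
  zclosed X /\ zirreducible X.

Definition vanish_on n (X : pset n) (p : {mpoly k[n.+1]}) : Prop :=
  forall x, X x -> p.@[x 0] = 0.

(* An element of the function field k(X) is represented by a fraction         *)
(* f.1 / f.2 of forms of the same degree, with f.2 not identically zero on X. *)
Definition fraction n := ({mpoly k[n.+1]} * {mpoly k[n.+1]})%type.

Definition ratfun n (X : pset n) (f : fraction n) : Prop :=
  (exists d, f.1 \is d.-homog /\ f.2 \is d.-homog) /\ ~ vanish_on X f.2.

Definition ratfun_eq n (X : pset n) (f g : fraction n) : Prop :=
  vanish_on X (f.1 * g.2 - g.1 * f.2).

Definition frac_mul n (f g : fraction n) : fraction n := (f.1 * g.1, f.2 * g.2).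

Definition frac_inv n (f : fraction n) : fraction n := (f.2, f.1).

Definition has_value n (X : pset n) (f : fraction n) (x : 'rV[k]_n.+1) (a : k) :=
  exists g, [/\ ratfun X g, ratfun_eq X f g, g.2.@[x 0] != 0
              & a = g.1.@[x 0] / g.2.@[x 0]].

Definition regular_at n (X : pset n) (f : fraction n) x : Prop :=
  exists a, has_value X f x a.

(* f is a unit of the local ring of X at x. *)
Definition unit_at n (X : pset n) (f : fraction n) x : Prop :=
  exists2 a, a != 0 & has_value X f x a.

(* The dimension of X is the transcendence degree of k(X) over k.             *)
(* On an irreducible X, a polynomial expression in rational functions is zero *)
(* in k(X) iff it takes the value zero wherever the denominators do not       *)
(* vanish.                                                                    *)
Definition alg_independent n (X : pset n) t (f : 'I_t -> fraction n) : Prop :=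
  forall P : {mpoly k[t]},
    (forall x, X x -> (forall i, (f i).2.@[x 0] != 0) ->
       P.@[fun i => (f i).1.@[x 0] / (f i).2.@[x 0]] = 0) ->
    P = 0.

Definition variety_dim n (X : pset n) (r : nat) : Prop :=
  (exists2 f : 'I_r -> fraction n,
     forall i, ratfun X (f i) & alg_independent X f) /\
  (forall f : 'I_r.+1 -> fraction n,
     (forall i, ratfun X (f i)) -> ~ alg_independent X f).

Definition pmap n m := 'rV[k]_n.+1 -> 'rV[k]_m.+1 -> Prop.

Definition pcomp n m p (f : pmap n m) (g : pmap m p) : pmap n p :=
  fun x z => exists2 y, f x y & g y z.

(* Equality of rational maps on X: both sides are defined and agree on a      *)
(* dense open subset.                                                         *)
Definition pmap_eq n m (X : pset n) (f g : pmap n m) : Prop :=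
  exists2 U, dense_open X U & forall x, U x -> exists2 y, f x y & g x y.

Definition mutually_inverse n m (X : pset n) (Y : pset m)
    (f : pmap n m) (g : pmap m n) : Prop :=
  pmap_eq X (pcomp f g) (@same_pt n) /\ pmap_eq Y (pcomp g f) (@same_pt m).

Definition forms n m := 'I_m.+1 -> {mpoly k[n.+1]}.

Definition rational_map n m (X : pset n) (F : forms n m) : Prop :=
  (exists d, forall i, F i \is d.-homog) /\ exists i, ~ vanish_on X (F i).

Definition forms_eq n m (X : pset n) (F G : forms n m) : Prop :=
  forall i j, vanish_on X (F i * G j - G i * F j).

(* The rational map X --> P^m defined by F, on its largest domain: x is in    *)
(* the domain as soon as some representative of the map is nonzero at x.      *)
Definition rmap n m (X : pset n) (F : forms n m) : pmap n m :=
  fun x y => X x /\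
    exists G, [/\ rational_map X G, forms_eq X F G
                & same_pt (\row_i (G i).@[x 0]) y].

(* A line bundle on the integral variety X is O_X(D) for a Cartier divisor D, *)
(* given by an open cover and a nonzero rational function, the local equation *)
(* of D, on each member of the cover.                                         *)
Record cartier_divisor n (X : pset n) := CartierDivisor {
  cd_index : Type;
  cd_cover : cd_index -> pset n;
  cd_eqn : cd_index -> fraction n;
  cd_open : forall i, zopen_in X (cd_cover i);
  cd_covers : forall x, X x -> exists i, cd_cover i x;
  cd_ratfun : forall i, ratfun X (cd_eqn i);
  cd_neq0 : forall i, ~ vanish_on X (cd_eqn i).1;
  cd_compat : forall i j x, cd_cover i x -> cd_cover j x ->
    unit_at X (frac_mul (cd_eqn i) (frac_inv (cd_eqn j))) x
}.

Arguments cd_cover {n X} c _ _.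
Arguments cd_eqn {n X} c _.

(* Global sections of O_X(D) are the rational functions s such that s * g is  *)
(* regular wherever g is a local equation of D.                               *)
Record linear_system n (X : pset n) (m : nat) := LinearSystem {
  ls_div : cartier_divisor X;
  ls_sec : 'I_m.+1 -> fraction n;
  ls_ratfun : forall j, ratfun X (ls_sec j);
  ls_global : forall i j x, cd_cover ls_div i x ->
    regular_at X (frac_mul (ls_sec j) (cd_eqn ls_div i)) x;
  ls_neq0 : exists j, ~ vanish_on X (ls_sec j).1
}.

(* x |-> [L_0(x), ..., L_m(x)], the sections being evaluated in a local       *)
(* trivialization of the line bundle around x.                                *)
Definition ls_map n (X : pset n) m (L : linear_system X m) : pmap n m :=
  fun x y => exists (i : cd_index (ls_div L)) (v : 'rV[k]_m.+1),
    [/\ cd_cover (ls_div L) i x,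
        forall j,
          has_value X (frac_mul (ls_sec L j) (cd_eqn (ls_div L) i)) x (v 0 j)
      & same_pt v y].

Definition ls_image n (X : pset n) m (L : linear_system X m) : pset m :=
  zclosure (fun y => exists x, ls_map L x y).

Definition birational_embedding n (X : pset n) m (L : linear_system X m) : Prop :=
  exists2 G : forms m n,
    rational_map (ls_image L) G &
    mutually_inverse X (ls_image L) (ls_map L) (rmap (ls_image L) G).

Definition birational_self_map m (F : forms m m) : Prop :=
  rational_map (@pspace m) F /\
  exists2 G : forms m m, rational_map (@pspace m) G &
    mutually_inverse (@pspace m) (@pspace m)
      (rmap (@pspace m) F) (rmap (@pspace m) G).

Definition defined_at_general_pt n m (Y : pset n) (f : pmap n m) : Prop :=
  exists2 V, dense_open Y V & forall y, V y -> exists z, f y z.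

Definition cremona_equivalent n (X : pset n) m (L G : linear_system X m) : Prop :=
  exists F : forms m m,
    [/\ birational_self_map F,
        defined_at_general_pt (ls_image G) (rmap (@pspace m) F)
      & pmap_eq X (ls_map L) (pcomp (ls_map G) (rmap (@pspace m) F))].

End ProjectiveGeometry.

(* Main.v *)
Require Import Defs.
From mathcomp Require Import all_boot all_order all_algebra ring.
From mathcomp.multinomials Require Import mpoly.
From Stdlib Require Import Classical.

Set Implicit Arguments.
Unset Strict Implicit.
Unset Printing Implicit Defensive.

Import GRing.Theory.

(** Why the theorem holds.  After clearing denominators, the two embeddings are
    x |-> [A_0 : ... : A_n] and x |-> [B_0 : ... : B_n], with A_j and B_j forms
    on X of one degree d > 0.  Being birational means that the A_j generate the
    function field of X, and so do the B_j ([embedding_generates]).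

    Let S_l be n+1 general linear combinations of the A_j, let T_l be n+1 general
    linear combinations of the B_j, and pass from T to S through the tuples
      (S_0, ..., S_(i-1), T_i, T_(i+1), ..., T_n).
    The ends of this chain differ from B and A by linear automorphisms of P^n.
    Consecutive tuples differ in one coordinate only; if the n coordinates they
    share generate the function field, the difference of the two coordinates
    that change is a rational function P/Q of the shared ones, and the
    de Jonquieres map y_i |-> y_i + P/Q, whose inverse is y_i |-> y_i - P/Q,
    carries one tuple to the other ([linked_de_jonquieres]).

    What remains is that the shared coordinates generate, and this is where
    n >= r + 2 enters.  They are n >= r + 2 elements y_l = sum_j c_lj a_lj, the
    family a_l being A or B, in a cone of dimension r + 1; hence they satisfy a
    nontrivial polynomial relation f(c, y) = 0 that holds for all coefficients c
    ([generic_relation]).  If f has minimal degree, some partial derivative of f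
    does not vanish identically on the points (c, y): otherwise all of them are
    zero polynomials, so f is constant or, k being perfect, a p-th power of a
    relation of smaller degree ([separable_relation]).  Differentiating the
    relation with respect to c_lj gives
      df/dc_lj + a_lj * df/dy_l = 0,
    so df/dy_l is not identically zero for some l, and then every member of the
    family a_l, that is, all A_j or all B_j, is a rational function of the y_l,
    already for general constant c ([generic_generators], [chain_generates]).

    The relation f is found by counting monomials ([algebraic_dependence]):
    if any q members of a finite family of functions are dependent, normal forms
    with respect to a graded monomial order make the space of polynomials of
    degree at most D in the family grow at most like D^(q-1), which leaves no
    room for q independent polynomials in the family. *)

(** * Values of polynomials over an infinite field *)

Lemma base_expansion_inj (B n : nat) (f g : nat -> nat) :
  (forall i, i < n -> f i < B) -> (forall i, i < n -> g i < B) ->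
  \sum_(i < n) f i * B ^ i = \sum_(i < n) g i * B ^ i ->
  forall i, i < n -> f i = g i.
Proof.
elim: n f g => [|n IH] f g fB gB //.
have shift (h : nat -> nat) :
    \sum_(i < n.+1) h i * B ^ i = \sum_(i < n) h i.+1 * B ^ i * B + h 0.
  rewrite big_ord_recl expn0 muln1 addnC; congr (_ + _).
  by apply: eq_bigr => i _; rewrite /= expnSr mulnA.
rewrite !shift -!big_distrl /= => e.
have e0 : f 0 = g 0.
  have := congr1 (modn^~ B) e.
  by rewrite !modnMDl !modn_small ?fB ?gB.
have B0 : 0 < B by apply: leq_ltn_trans (fB 0 _).
move: e; rewrite e0 => /addIn /eqP; rewrite eqn_pmul2r // => /eqP e [|i] //= iln.
apply: (IH (fun i => f i.+1) (fun i => g i.+1)) => // j jln; [exact: fB|exact: gB].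
Qed.

Section InfiniteField.
Variable k : closedFieldType.
Local Open Scope ring_scope.

Lemma poly_eq0_of_values (p : {poly k}) : (forall t, t != 0 -> p.[t] = 0) -> p = 0.
Proof.
move=> p0; apply/eqP/negPn/negP => /negPf pn0.
have : 'X * p != 0 by rewrite mulf_neq0 ?polyX_eq0 ?pn0.
case/closed_nonrootP => t; rewrite /root hornerM hornerX mulf_eq0 negb_or.
by case/andP => t0; rewrite p0 ?eqxx.
Qed.

(** Kronecker substitution: with B above all exponents of p, sending the i-th
    variable to t^(B^i) keeps the monomials of p distinct, so that p becomes a
    nonzero polynomial in t. *)
Lemma mpoly_neq0_value n (p : {mpoly k[n]}) : p != 0 -> exists v, p.@[v] != 0.
Proof.
move=> pn0; pose B := (\sum_(m <- msupp p) mdeg m).+1.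
pose w (m : 'X_{1..n}) := (\sum_(i < n) m i * B ^ i)%N.
pose q : {poly k} := \sum_(m <- msupp p) p@_m *: 'X^(w m).
have small m i : m \in msupp p -> (m i < B)%N.
  move=> mp; rewrite ltnS (leq_trans (n := mdeg m)) //.
    by rewrite mdegE (bigD1 i) //= leq_addr.
  by rewrite (bigD1_seq m) //= leq_addr.
have winj : {in msupp p &, injective w}.
  move=> m1 m2 h1 h2 e; apply/mnmP => i.
  pose F (m : 'X_{1..n}) (j : nat) := oapp m 0%N (insub j : option 'I_n).
  have FE (m : 'X_{1..n}) (j : 'I_n) : F m j = m j by rewrite /F valK.
  rewrite -!FE; apply: (@base_expansion_inj B n) => //.
  - by move=> j jn; rewrite (FE _ (Ordinal jn)) small.
  - by move=> j jn; rewrite (FE _ (Ordinal jn)) small.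
  - by under eq_bigr do rewrite FE; under [RHS]eq_bigr do rewrite FE.
have : q != 0.
  apply/eqP => /(congr1 (fun q : {poly k} => q`_(w (mlead p)))).
  rewrite coef0 coef_sum (bigD1_seq (mlead p)) ?mlead_supp //= big_seq_cond big1.
    by rewrite addr0 coefZ coefXn eqxx mulr1 => /eqP; rewrite mleadc_eq0 (negPf pn0).
  move=> m /andP[mp /negPf ml]; rewrite coefZ coefXn; case: eqP => [/esym e|]; last by rewrite mulr0.
  by move: ml; rewrite (winj _ _ mp (mlead_supp pn0) e) eqxx.
case/closed_nonrootP => t; rewrite /root => qt; exists (fun i => t ^+ (B ^ i)).
apply: contraNneq qt => <-; rewrite mevalE horner_sum; apply/eqP.
apply: eq_bigr => m _; rewrite hornerZ hornerXn -prodrXr; congr (_ * _).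
by apply: eq_bigr => i _; rewrite -exprM mulnC.
Qed.

Lemma mpoly_eq0_of_values n (p : {mpoly k[n]}) : (forall v, p.@[v] = 0) -> p = 0.
Proof.
by move=> p0; apply/eqP/negPn/negP => /mpoly_neq0_value[v]; rewrite p0 eqxx.
Qed.

Lemma dhomog_scale n d (p : {mpoly k[n]}) (c : k) (v : 'I_n -> k) :
  p \is d.-homog -> p.@[fun i => c * v i] = c ^+ d * p.@[v].
Proof.
move=> /dhomogP hp; rewrite !mevalE mulr_sumr big_seq [RHS]big_seq.
apply: eq_bigr => m mp; rewrite mulrCA; congr (_ * _).
by rewrite -(hp m mp) /= mdegE -prodrXr -big_split; apply: eq_bigr => i _; rewrite exprMn.
Qed.

(** The polynomial in c whose value is p at the point c v; its coefficients are
    the values at v of the homogeneous components of p. *)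
Definition ray n (p : {mpoly k[n]}) (v : 'I_n -> k) : {poly k} :=
  \poly_(d < msize p) (pihomog mdeg d p).@[v].

Lemma coef_ray n (p : {mpoly k[n]}) v d : (ray p v)`_d = (pihomog mdeg d p).@[v].
Proof.
rewrite coef_poly; case: ltnP => // dp; rewrite pihomogE big_seq_cond big1 ?meval0 //.
by move=> m /andP[/msize_mdeg_lt /= h /eqP e]; move: h; rewrite e ltnNge dp.
Qed.

Lemma horner_ray n (p : {mpoly k[n]}) v c : (ray p v).[c] = p.@[fun i => c * v i].
Proof.
rewrite [in RHS](pihomog_partitionE (leqnn (msize p))) raddf_sum horner_poly.
by apply: eq_bigr => d _; rewrite mulrC -(dhomog_scale _ _ (pihomogP mdeg d p)).
Qed.

Definition msubst n m (f : 'I_n -> {mpoly k[m]}) (p : {mpoly k[n]}) :=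
  p \mPo [tuple f i | i < n].

Lemma msubst_eval n m (f : 'I_n -> {mpoly k[m]}) p v :
  (msubst f p).@[v] = p.@[fun i => (f i).@[v]].
Proof. by rewrite comp_mpoly_meval; apply: meval_eq => i; rewrite tnth_mktuple. Qed.

Lemma msubst_homog n m (f : 'I_n -> {mpoly k[m]}) p d e :
  p \is d.-homog -> (forall i, f i \is e.-homog) -> msubst f p \is (e * d).-homog.
Proof.
move=> /dhomogP hp hf; rewrite /msubst comp_mpolyE big_seq.
apply: rpred_sum => a ap; apply: rpredZ; rewrite -(hp a ap) /= mdegE big_distrr /=.
elim/big_ind2: _ => [|? ? ? ? h1 h2|i _]; [exact: dhomog1|exact: dhomogM|].
by rewrite tnth_mktuple; apply: dhomogMn.
Qed.

End InfiniteField.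

(** * Algebraic dependence by counting monomials *)

Lemma msizeM_pred (k : closedFieldType) n (p q : {mpoly k[n]}) :
  (msize (p * q) <= (msize p + msize q).-1)%N.
Proof.
have [->|p0] := eqVneq p 0%R; first by rewrite mul0r msize0.
have [->|q0] := eqVneq q 0%R; first by rewrite mulr0 msize0.
by rewrite msizeM.
Qed.

Section Transcendence.
Variables (k : closedFieldType) (T : Type) (s q : nat) (g : 'I_s -> T -> k).
Local Open Scope ring_scope.

Local Notation "p @* t" := (p.@[fun i => g i t]) (at level 50).

Hypothesis g_dep : forall J : {set 'I_s}, #|J| = q.+1 ->
  exists R : {mpoly k[s]}, [/\ R != 0,
    forall m, m \in msupp R -> forall i, i \notin J -> m i = 0%N &
    forall t, R @* t = 0].

Definition few_large (E : nat) (m : 'X_{1..s}) := (#|[set i | (E <= m i)%N]| <= q)%N.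

(** Normal forms are polynomials rather than mere linear combinations of the
    functions, so that their coefficients are available to the counting argument. *)
Definition has_nf (E D : nat) (p : {mpoly k[s]}) := exists f : {mpoly k[s]},
  (forall t, f @* t = p @* t) /\
  (forall m, m \in msupp f -> few_large E m /\ (mdeg m <= D)%N).

Lemma has_nf_comb E D (I : Type) (r : seq I) (c : I -> k) (p : I -> {mpoly k[s]}) :
  (forall i, has_nf E D (p i)) -> has_nf E D (\sum_(i <- r) c i *: p i).
Proof.
move=> h; elim: r => [|i r [f [fe fs]]].
  by exists 0; split=> [t|m]; [rewrite big_nil !meval0 | rewrite msupp0].
have [f' [fe' fs']] := h i.
exists (c i *: f' + f); split=> [t|m].
  by rewrite big_cons !mevalD !mevalZ fe fe'.
by move/msuppD_le; rewrite mem_cat => /orP[/msuppZ_le|]; [apply: fs'|apply: fs].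
Qed.

Lemma has_nf_supp E D (p : {mpoly k[s]}) :
  (forall m, m \in msupp p -> has_nf E D 'X_[m]) -> has_nf E D p.
Proof.
move=> h.
have h' (m : 'X_{1..s}) : has_nf E D (if m \in msupp p then 'X_[m] else 0).
  case: ifP => [/h //|_]; exists 0; split=> [t|?] //; by rewrite msupp0.
have := has_nf_comb (msupp p) (fun m => p@_m) h'.
suff -> : \sum_(m <- msupp p) p@_m *: (if m \in msupp p then 'X_[m] else 0) = p by [].
by rewrite [RHS]mpolyE big_seq [RHS]big_seq; apply: eq_bigr => m ->.
Qed.

(** A monomial with more than q large exponents is a multiple of the leading
    monomial of the relation attached to q+1 of the variables involved, so it can
    be rewritten with smaller monomials.  The order is graded, hence degrees do
    not grow, and it is well founded. *)
Lemma normal_forms : exists E, forall D (p : {mpoly k[s]}),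
  (msize p <= D.+1)%N -> has_nf E D p.
Proof.
have h (J : {set 'I_s}) : exists R : {mpoly k[s]}, #|J| = q.+1 -> [/\ R != 0,
    forall m, m \in msupp R -> forall i, i \notin J -> m i = 0%N &
    forall t, R @* t = 0].
  case: (eqVneq #|J| q.+1) => [/g_dep[R hR]|/eqP]; first by exists R.
  by exists 0.
have {h} [R hR] := fin_all_exists h.
(* E bounds every exponent of every leading monomial mlead (R J). *)
pose E := (\sum_(J : {set 'I_s}) mdeg (mlead (R J)))%N.
exists E => D.
suff mono m : (mdeg m <= D)%N -> has_nf E D ('X_[m] : {mpoly k[s]}).
  move=> p pD; apply: has_nf_supp => m mp; apply: mono.
  by rewrite -ltnS (leq_trans _ pD) ?msize_mdeg_lt.
elim/(@ltmwf s): m => m IH mD.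
case: (boolP (few_large E m)) => [fl|].
  exists 'X_[m]; split=> // m'; rewrite msuppX inE => /eqP -> //.
rewrite /few_large -ltnNge => big.
have [J [JE Jq]] : exists J : {set 'I_s}, (forall i, i \in J -> E <= m i)%N /\ #|J| = q.+1.
  case/card_geqP: big => [u [uu us ul]]; exists [set i in u]; split.
    by move=> i; rewrite inE => /ul; rewrite inE.
  by rewrite cardsE -us; apply/card_uniqP.
have [Rn0 RJ Rg] := hR J Jq.
set mu := mlead (R J).
have mum : (mu <= m)%MM.
  apply/mnm_lepP => i; case: (boolP (i \in J)) => iJ; last first.
    by rewrite (RJ mu (mlead_supp Rn0)).
  apply: leq_trans (JE i iJ); rewrite /E (bigD1 J) //=.
  by apply: leq_trans (leq_addr _ _); rewrite mdegE (bigD1 i) //= leq_addr.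
(* The multiple of R J with the same leading term as the monomial m. *)
pose c := mleadc (R J).
have c0 : c != 0 by rewrite /c mleadc_eq0.
pose S := c^-1 *: (R J * 'X_[m - mu]).
pose p := 'X_[m] - S.
have [f [fe fs]] : has_nf E D p.
  apply: has_nf_supp => m' m'p.
  have m'0 : p@_m != 0 -> False.
    rewrite mcoeffB mcoeffX eqxx mcoeffZ.
    have -> : (R J * 'X_[m - mu])@_m = c by rewrite -{1}(submK mum) mcoeffMX.
    by rewrite mulVf // subrr eqxx.
  have ne : m' != m by apply/eqP => e; apply: m'0; rewrite -e -mcoeff_msupp.
  have le : (m' <= m)%O.
    move: m'p => /msuppB_le; rewrite mem_cat msuppX inE => /orP[/eqP->//|].
    move/msuppZ_le; rewrite (perm_mem (msuppMX _ _)) => /mapP[m2 m2R ->].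
    by rewrite -{2}(submK mum) lemc_add2r msupp_le_mlead.
  apply: IH; first by rewrite Order.POrderTheory.lt_neqAle ne le.
  by apply: leq_trans mD; apply: lemc_mdeg.
exists f; split=> // t; rewrite fe mevalB mevalZ mevalM Rg mul0r mulr0 subr0 //.
Qed.

(** Over-counts the monomials with at most q large exponents: the first component
    names, for each variable, one of q slots or (with the value q) none; the
    second holds the small exponents and the third the large ones. *)
Lemma few_large_param E D : exists2 I : finType,
    #|I| = (q.+1 ^ s * E.+1 ^ s * D.+1 ^ q)%N &
  exists gam : I -> 'X_{1..s}, forall m,
    few_large E m -> (mdeg m <= D)%N -> exists i, m = gam i.
Proof.
exists (({ffun 'I_s -> 'I_q.+1} * {ffun 'I_s -> 'I_E.+1}) * {ffun 'I_q -> 'I_D.+1})%type.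
  by rewrite !card_prod !card_ffun !card_ord.
exists (fun x : {ffun 'I_s -> 'I_q.+1} * {ffun 'I_s -> 'I_E.+1} * {ffun 'I_q -> 'I_D.+1} =>
  [multinom (if insub (x.1.1 i : nat) is Some l then x.2 l : nat else x.1.2 i) | i < s])
  => m fl mD.
pose J := [set i | (E <= m i)%N].
exists ([ffun i => if i \in J then inord (index i (enum J)) else ord_max],
        [ffun i => inord (m i)],
        [ffun l : 'I_q => inord (nth 0%N (map m (enum J)) l)]).
apply/mnmP => i; rewrite mnmE /= !ffunE.
have mi : (m i <= D)%N by apply: leq_trans mD; rewrite mdegE (bigD1 i) //= leq_addr.
case: ifP => iJ.
  have ieJ : (index i (enum J) < #|J|)%N by rewrite cardE index_mem mem_enum.
  have iq := leq_trans ieJ fl.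
  rewrite inordK; last by rewrite ltnS ltnW.
  rewrite (insubT (fun x => x < q)%N iq) /= ffunE.
  by rewrite (nth_map i) ?nth_index ?inordK ?ltnS ?mem_enum // -cardE.
rewrite insubF /= ?ltnn // inordK // ltnS ltnW //.
by move: iJ; rewrite inE ltnNge => ->.
Qed.

(** The M^(q+1) products of the phi l with exponents below M have degree at most
    D = (q+1) M d, hence normal forms built from only O(D^q) monomials.  For M
    large these normal forms are linearly dependent. *)
Lemma algebraic_dependence (phi : 'I_q.+1 -> {mpoly k[s]}) :
  exists f : {mpoly k[q.+1]}, f != 0 /\ forall t, f.@[fun l => phi l @* t] = 0.
Proof.
have [E nf] := normal_forms.
pose d := (\max_l msize (phi l))%N.
pose C := (q.+1 ^ s * E.+1 ^ s)%N.
pose M := (C * (q.+1 * d).+1 ^ q).+1.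
pose D := (q.+1 * M * d)%N.
pose mon (a : {ffun 'I_q.+1 -> 'I_M}) := [multinom (a l : nat) | l < q.+1].
have mon_inj : injective mon.
  move=> a b /mnmP h; apply/ffunP => l; apply/val_inj.
  by have := h l; rewrite !mnmE.
pose Phi a := msubst phi ('X_[mon a]).
have nfPhi a : exists f : {mpoly k[s]}, (forall t, f @* t = Phi a @* t) /\
    (forall m, m \in msupp f -> few_large E m /\ (mdeg m <= D)%N).
  apply: nf; rewrite /Phi /msubst comp_mpolyX.
  have powb n (p : {mpoly k[s]}) : (msize p <= d -> msize (p ^+ n) <= (n * d).+1)%N.
    move=> pd; elim: n => [|n IH]; first by rewrite expr0 msize1.
    rewrite exprS; apply: leq_trans (msizeM_pred _ _) _.
    by rewrite -subn1 leq_subLR add1n mulSn -addnS (leq_trans (leq_add pd IH)) // leqnSn.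
  have pd l : (msize (phi l) <= d)%N by apply: leq_bigmax.
  suff h (r : seq 'I_q.+1) : (msize (\prod_(l <- r) tnth [tuple phi l | l < q.+1] l ^+ mon a l)
      <= (size r * M * d).+1)%N.
    by have := h (enum 'I_q.+1); rewrite big_enum size_enum_ord.
  elim: r => [|l r IH]; first by rewrite big_nil msize1.
  rewrite big_cons; apply: leq_trans (msizeM_pred _ _) _.
  rewrite tnth_mktuple mnmE.
  have h1 : (msize (phi l ^+ a l) <= (M * d).+1)%N.
    apply: leq_trans (powb _ _ (pd l)) _; rewrite ltnS leq_mul2r.
    by rewrite orbC ltnW.
  by rewrite -subn1 leq_subLR add1n /= mulSn mulnDl -addSn -addnS leq_add.
have [nfP hnf] := fin_all_exists nfPhi.
have [I cI [gam hgam]] := few_large_param E D.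
pose A := {ffun 'I_q.+1 -> 'I_M}.
have cA : #|{: A}| = (M ^ q.+1)%N by rewrite card_ffun !card_ord.
(* D + 1 <= M ((q+1) d + 1), so #|I| <= C ((q+1) d + 1)^q M^q < M^(q+1). *)
have lt : (#|I| < #|{: A}|)%N.
  rewrite cI cA -/C expnS [X in (_ < X)%N]mulnC.
  apply: (@leq_ltn_trans (M ^ q * (C * (q.+1 * d).+1 ^ q))).
    rewrite mulnCA leq_mul2l; apply/orP; right.
    rewrite -expnMn; case: (posnP q) => [->|q0]; first by rewrite !expn0.
    by rewrite leq_exp2r // /D mulnS [(q.+1 * M)%N]mulnC -mulnA -add1n leq_add2r.
  by rewrite ltn_mul2l expn_gt0 /= ltnS leqnn.
pose B := \matrix_(i < #|{: A}|, j < #|I|) (nfP (enum_val i))@_(gam (enum_val j)).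
have : kermx B != 0.
  rewrite -mxrank_eq0 mxrank_ker -lt0n subn_gt0.
  by apply: leq_ltn_trans lt; apply: rank_leq_col.
case/rowV0Pn => la /sub_kermxP laB la0.
pose coef a := la 0 (enum_rank a).
exists (\sum_(a : A) coef a *: 'X_[mon a]); split.
  case/rV0Pn: la0 => i lai; apply/eqP => /(congr1 (fun p => p@_(mon (enum_val i)))).
  rewrite raddf_sum /= mcoeff0 (bigD1 (enum_val i)) //= big1.
    by rewrite addr0 mcoeffZ mcoeffX eqxx mulr1 /coef enum_valK => /eqP; rewrite (negPf lai).
  move=> a ne; rewrite mcoeffZ mcoeffX; case: eqP => [/mon_inj e|]; last by rewrite mulr0.
  by rewrite e eqxx in ne.
have nf0 : \sum_(a : A) coef a *: nfP a = 0.
  apply/mpolyP => m; rewrite mcoeff0 raddf_sum /=.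
  case: (classic (few_large E m /\ (mdeg m <= D)%N)) => [[fl mD]|nfl]; last first.
    apply: big1 => a _; rewrite mcoeffZ memN_msupp_eq0 ?mulr0 //.
    by apply/negP => /(proj2 (hnf a)).
  have [i ->] := hgam m fl mD.
  have /rowP/(_ (enum_rank i)) := laB; rewrite !mxE => {2}<-.
  rewrite (reindex (fun i : 'I_#|{: A}| => enum_val i)) /=; last first.
    by apply: onW_bij; apply: enum_val_bij.
  by apply: eq_bigr => j _; rewrite mxE enum_rankK mcoeffZ /coef enum_valK.
move=> t; rewrite raddf_sum /=.
have := congr1 (fun p => p @* t) nf0; rewrite /= meval0 raddf_sum /= => {2}<-.
apply: eq_bigr => a _; rewrite !mevalZ (proj1 (hnf a)) /Phi msubst_eval //.
Qed.
End Transcendence.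

Lemma algebraic_dependence_pos (k : closedFieldType) (T : Type) (s q : nat)
    (g : 'I_s -> T -> k) : (0 < q)%N ->
  (forall J : {set 'I_s}, #|J| = q -> exists R : {mpoly k[s]}, [/\ R != 0%R,
    forall m, m \in msupp R -> forall i, i \notin J -> m i = 0%N &
    forall t, R.@[fun i => g i t] = 0%R]) ->
  forall phi : 'I_q -> {mpoly k[s]},
  exists f : {mpoly k[q]}, f != 0%R /\
    forall t, f.@[fun l => (phi l).@[fun i => g i t]] = 0%R.
Proof. by case: q => // q _ g_dep phi; exact: algebraic_dependence. Qed.

(** * Relations of minimal degree are separable *)

Section Separable.
Variables (k : closedFieldType) (n : nat).
Local Open Scope ring_scope.
Implicit Types (f g : {mpoly k[n]}) (v w : 'I_n -> k).

(** First-order Taylor expansion along a line; all that is needed is a chain rule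
    that holds in every characteristic. *)
Lemma taylor1 f v w : exists q : {poly k}, forall t,
  f.@[fun i => v i + t * w i] =
    f.@[v] + t * (\sum_i w i * f^`M(i).@[v]) + t ^+ 2 * q.[t].
Proof.
pose P f := exists q : {poly k}, forall t, f.@[fun i => v i + t * w i] =
    f.@[v] + t * (\sum_i w i * f^`M(i).@[v]) + t ^+ 2 * q.[t].
have P0 (c : k) : P c%:MP.
  exists 0 => t; rewrite !mevalC big1 ?mulr0 ?horner0 ?mulr0 ?addr0 // => i _.
  by rewrite mderivC meval0 mulr0.
have PD f1 f2 : P f1 -> P f2 -> P (f1 + f2).
  case=> q1 h1 [q2 h2]; exists (q1 + q2) => t; rewrite !mevalD h1 h2 hornerD.
  under [in RHS]eq_bigr do rewrite mderivD mevalD mulrDr.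
  by rewrite big_split /=; ring.
have PM f1 f2 : P f1 -> P f2 -> P (f1 * f2).
  case=> q1 h1 [q2 h2].
  pose A1 := \sum_i w i * f1^`M(i).@[v]; pose A2 := \sum_i w i * f2^`M(i).@[v].
  exists ((A1 * A2)%:P + f1.@[v] *: q2 + f2.@[v] *: q1 + 'X * (A1 *: q2 + A2 *: q1)
          + 'X^2 * (q1 * q2)) => t.
  rewrite !mevalM h1 h2 -/A1 -/A2 !hornerE.
  have -> : \sum_i w i * (f1 * f2)^`M(i).@[v] = f1.@[v] * A2 + f2.@[v] * A1.
    rewrite !mulr_sumr -big_split; apply: eq_bigr => i _ /=.
    by rewrite mderivM mevalD !mevalM; ring.
  by rewrite /=; ring.
have PX i : P 'X_i.
  exists 0 => t; rewrite !mevalXU horner0 mulr0 addr0; congr (_ + _ * _).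
  rewrite (bigD1 i) //= big1 => [|j ji]; rewrite mderivX mevalZ.
    have -> : (U_(i) - U_(i) = 0)%MM by apply/mnmP => j; rewrite mnmBE mnm0E subnn.
    by rewrite mnm1E eqxx /= mul1r mpolyX0 meval1 mulr1 addr0.
  by rewrite mnm1E eq_sym (negPf ji) mul0r mulr0.
rewrite -/(P f) [f]mpolyE; apply: (big_ind P) => [|//|m _].
  by rewrite -[0]/(0%:MP); exact: P0.
rewrite -mul_mpolyC; apply: (PM _ _ (P0 _)); rewrite mpolyXE_id.
apply: (big_ind P) => [|//|i _]; first by rewrite -mpolyC1; exact: P0.
elim: (m i) => [|d IH]; first by rewrite expr0 -mpolyC1; exact: P0.
by rewrite exprS; apply: PM.
Qed.

Lemma dir_deriv_eq0 f v w :
  (forall t, f.@[fun i => v i + t * w i] = 0) -> \sum_i w i * f^`M(i).@[v] = 0.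
Proof.
move=> f0; have [q hq] := taylor1 f v w.
have fv : f.@[v] = 0.
  by rewrite -(f0 0); apply: meval_eq => i; rewrite mul0r addr0.
set A := \sum_i _ in hq *.
(* f vanishes on the line, so t (A + t q(t)) = 0 for all t; divide by t. *)
suff /(congr1 (horner^~ 0)) : A%:P + 'X * q = 0 by rewrite !hornerE.
apply: poly_eq0_of_values => t t0; apply: (mulfI t0).
by rewrite !hornerE -[RHS](f0 t) hq fv; ring.
Qed.

Lemma closed_root (a : k) e : (0 < e)%N -> exists b, b ^+ e = a.
Proof.
move=> e0; have : size ('X^e - a%:P) != 1%N by rewrite size_XnsubC // eqSS -lt0n.
by case/closed_rootP => b; rewrite /root !hornerE subr_eq0 => /eqP <-; exists b.
Qed.

(** If all derivatives of f vanish, every exponent in f is zero in k, so f is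
    constant or all exponents are divisible by p = char k; in the second case,
    take p-th roots of the coefficients and divide the exponents by p. *)
Lemma perfect_root f : (forall i, f^`M(i) = 0) -> f != 0 ->
  (exists c, f = c%:MP) \/
  exists g e, [/\ (msize g < msize f)%N, g != 0 & forall v, g.@[v] ^+ e = f.@[v]].
Proof.
move=> df f0.
have dvd m i : m \in msupp f -> (m i)%:R = 0 :> k.
  case: (posnP (m i)) => [->//|mi0 mf].
  have := congr1 (fun p : {mpoly k[n]} => p@_(m - U_(i))) (df i).
  rewrite mcoeff_deriv mcoeff0 submK; last by rewrite lep1mP -lt0n.
  rewrite mnmBE mnm1E eqxx subn1 prednK // -[f@_m *+ _]mulr_natr => /eqP.
  by rewrite mulf_eq0 mcoeff_eq0 mf => /eqP.
case: (leqP (msize f) 1) => [/msize1_polyC ->|szf]; first by left; eexists.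
right; set m0 := mlead f.
have m0f : m0 \in msupp f by exact: mlead_supp.
have : m0 != 0%MM by rewrite -mdeg_eq0 -lt0n -ltnS mlead_deg.
move=> m0n0; have [i m0i] : exists i, (0 < m0 i)%N.
  apply: NNPP => h; case/negP: m0n0; apply/eqP/mnmP => i; rewrite mnm0E.
  by apply/eqP; rewrite -leqn0 leqNgt; apply/negP => ?; apply: h; exists i.
have [p pk] : exists p, p \in [pchar k].
  by have [p] := natf0_pchar m0i (introT eqP (dvd m0 i m0f)); exists p.
have pm m j : m \in msupp f -> (p %| m j)%N.
  by move=> mf; rewrite (dvdn_pcharf pk) dvd.
have p0 : (1 < p)%N by apply: prime_gt1; exact: pcharf_prime pk.
have [r hr] : exists r : k -> k, forall a : k, r a ^+ p = a.
  have h (a : k) : {b | b ^+ p == a}.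
    by apply: sigW; have [b <-] := closed_root a (ltnW p0); exists b.
  by exists (fun a => sval (h a)) => a; case: (h a) => /= b /eqP.
pose dv (m : 'X_{1..n}) : 'X_{1..n} := [multinom (m j %/ p)%N | j < n].
pose g := \sum_(m <- msupp f) r f@_m *: 'X_[dv m].
have gf v : g.@[v] ^+ p = f.@[v].
  have -> : g.@[v] = \sum_(m <- msupp f) r f@_m * \prod_j v j ^+ dv m j.
    by rewrite (raddf_sum (meval v)); apply: eq_bigr => m _; rewrite /= mevalZ mevalX.
  rewrite [RHS]mevalE -(pFrobenius_autE pk) rmorph_sum big_seq [RHS]big_seq /=.
  apply: eq_bigr => m mf; rewrite pFrobenius_autE exprMn hr; congr (_ * _).
  by rewrite -prodrXl; apply: eq_bigr => j _; rewrite mnmE -exprM divnK ?pm.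
exists g, p; split=> //; last first.
  apply: contraNneq f0 => g0; apply/eqP/mpoly_eq0_of_values => v.
  by rewrite -gf g0 meval0 expr0n; case: p p0 {pk pm hr dv g gf g0}.
apply: leq_ltn_trans (mmeasure_sum _ _ _ _) _; rewrite -(mlead_deg f0) ltnS.
apply/bigmax_leqP_seq => m mf _; apply: leq_trans (mmeasureZ_le _ _ _) _.
rewrite msizeX.
have dm : (mdeg (dv m) * p = mdeg m)%N.
  rewrite !mdegE big_distrl; apply: eq_bigr => j _; rewrite mnmE /= divnK ?pm //.
have := lemc_mdeg (msupp_le_mlead mf); rewrite -dm => le.
case: (posnP (mdeg (dv m))) => [->|d0]; first by rewrite lt0n mdeg_eq0.
by apply: leq_trans le; rewrite -{1}[mdeg _]muln1 ltn_mul2l d0.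
Qed.

(** Descent on the degree: a derivative that vanishes on S is a relation of
    smaller degree, unless it is zero; if all derivatives are zero, a p-th root
    of the relation is a smaller relation. *)
Lemma separable_relation (S : ('I_n -> k) -> Prop) f : (exists v, S v) ->
  f != 0 -> (forall v, S v -> f.@[v] = 0) ->
  exists f' i, (forall v, S v -> f'.@[v] = 0) /\ exists2 v, S v & f'^`M(i).@[v] != 0.
Proof.
move=> [v0 Sv0]; move: {2}(msize f) (leqnn (msize f)) => N.
elim: N f => [|N IH] f; first by rewrite leqn0 msize_poly_eq0 => ->.
move=> szf f0 fS.
case: (classic (exists i, f^`M(i) != 0)) => [[i di]|nd].
  case: (classic (forall v, S v -> f^`M(i).@[v] = 0)) => [h|h].
    apply: (IH _ _ di h); rewrite -ltnS; apply: leq_trans szf.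
    rewrite -(mlead_deg di) -(mlead_deg f0) ltnS.
    have : mlead f^`M(i) \in msupp f^`M(i) by exact: mlead_supp.
    rewrite mcoeff_msupp mcoeff_deriv => h1.
    have /msupp_le_mlead/lemc_mdeg : (mlead f^`M(i) + U_(i))%MM \in msupp f.
      by rewrite mcoeff_msupp; apply: contraNneq h1 => ->; rewrite mul0rn.
    by rewrite mdegD mdeg1 addn1.
  exists f, i; split=> //; apply: NNPP => h'; apply: h => v Sv.
  by apply/eqP/negPn/negP => fv; apply: h'; exists v.
have df i : f^`M(i) = 0.
  by apply/eqP/negPn/negP => di; apply: nd; exists i.
case: (perfect_root df f0) => [[c fc]|[g [e [szg g0 ge]]]].
  by move: f0 (fS v0 Sv0); rewrite fc mevalC mpolyC_eq0 => /eqP c0.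
apply: (IH g _ g0) => [|v Sv]; first by rewrite -ltnS (leq_trans szg).
by have /eqP := fS v Sv; rewrite -ge expf_eq0 => /andP[_ /eqP].
Qed.
End Separable.

(** * Polynomials on a projective variety *)

Section Variety.
Variables (k : closedFieldType) (N : nat) (X : pset k N).
Hypothesis X_var : projective_variety X.
Local Open Scope ring_scope.
Implicit Types (p q : {mpoly k[N.+1]}) (x : 'rV[k]_N.+1).

Lemma nonvanish_value p : ~ vanish_on X p -> exists2 x, X x & p.@[x 0] != 0.
Proof.
move=> h; apply: NNPP => h'; apply: h => x Xx.
by apply/eqP/negPn/negP => px; apply: h'; exists x.
Qed.

Lemma value_nonvanish p x : X x -> p.@[x 0] != 0 -> ~ vanish_on X p.
Proof. by move=> Xx px0 /(_ x Xx) px; rewrite px eqxx in px0. Qed.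

Lemma variety_neq0 x : X x -> x != 0.
Proof. by case: X_var => [[S [_ hX]] _] /hX[]. Qed.

Lemma variety_cone x (c : k) : X x -> c != 0 -> X (c *: x).
Proof.
case: X_var => [[S [Sh hX]] _] /hX[x0 Sx] c0; apply/hX; split.
  by rewrite scaler_eq0 negb_or c0.
move=> p Sp; have [d pd] := Sh p Sp.
rewrite (@meval_eq _ _ _ (fun i => c * x 0 i)) => [|i]; last by rewrite mxE.
by rewrite (dhomog_scale _ _ pd) Sx // mulr0.
Qed.

Lemma zclosed_form n (p : {mpoly k[n.+1]}) d : p \is d.-homog ->
  zclosed (fun x : 'rV[k]_n.+1 => x != 0 /\ p.@[x 0] = 0).
Proof.
move=> pd; exists (eq^~ p); split=> [_ ->|x]; first by exists d.
by split=> -[x0 h]; split=> //; [move=> _ -> | apply: h].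
Qed.

Lemma form_prime p q d e : p \is d.-homog -> q \is e.-homog ->
  ~ vanish_on X p -> ~ vanish_on X q -> exists2 x, X x & p.@[x 0] != 0 /\ q.@[x 0] != 0.
Proof.
move=> pd qe np nq; apply: NNPP => h.
case: X_var => _ [_ irr].
case: (irr _ _ (zclosed_form pd) (zclosed_form qe)) => [x Xx|h1|h1].
- case: (eqVneq p.@[x 0] 0) => [px|px]; first by left; split=> //; exact: variety_neq0.
  right; split; first exact: variety_neq0.
  by apply/eqP/negPn/negP => qx; apply: h; exists x.
- by apply: np => x /h1[].
- by apply: nq => x /h1[].
Qed.

Lemma eval_scaled p (c : k) x : p.@[(c *: x) 0] = (ray p (x 0)).[c].
Proof. by rewrite horner_ray; apply: meval_eq => i; rewrite mxE. Qed.

Lemma nonvanish_component p : ~ vanish_on X p ->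
  exists d, ~ vanish_on X (pihomog mdeg d p).
Proof.
move=> np; apply: NNPP => h; apply: np => x Xx.
rewrite [p](pihomog_partitionE (leqnn (msize p))) raddf_sum big1 // => d _.
apply: NNPP => hd; apply: h; exists (d : nat) => hv; apply: hd; exact: hv.
Qed.

(** The definition of irreducibility speaks of forms only.  For arbitrary p and
    q, choose a point where some homogeneous component of each is nonzero; on the
    line through it, p and q are nonzero polynomials in the scalar. *)
Lemma variety_prime p q : ~ vanish_on X p -> ~ vanish_on X q ->
  exists2 x, X x & p.@[x 0] != 0 /\ q.@[x 0] != 0.
Proof.
move=> /nonvanish_component[d pd] /nonvanish_component[e qe].
have [x Xx []] := form_prime (pihomogP _ _ _) (pihomogP _ _ _) pd qe.
rewrite -!coef_ray => p0 q0.
have : 'X * (ray p (x 0) * ray q (x 0)) != 0.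
  rewrite !mulf_neq0 ?polyX_eq0 //.
    by apply: contraNneq p0 => ->; rewrite coef0.
  by apply: contraNneq q0 => ->; rewrite coef0.
case/closed_nonrootP => c; rewrite /root !hornerM hornerX !mulf_eq0 !negb_or.
case/and3P => c0 pc qc; exists (c *: x); first exact: variety_cone.
by rewrite !eval_scaled.
Qed.

Lemma nonvanishM p q : ~ vanish_on X p -> ~ vanish_on X q -> ~ vanish_on X (p * q).
Proof.
move=> np nq; have [x Xx [px qx]] := variety_prime np nq.
by apply: (value_nonvanish Xx); rewrite mevalM mulf_neq0.
Qed.

Lemma nonvanish1 : ~ vanish_on X 1.
Proof.
case: X_var => _ [[x Xx] _]; apply: (value_nonvanish Xx).
by rewrite meval1 oner_neq0.
Qed.

Lemma nonvanish_prod (I : Type) (r : seq I) (p : I -> {mpoly k[N.+1]}) :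
  (forall i, ~ vanish_on X (p i)) -> ~ vanish_on X (\prod_(i <- r) p i).
Proof.
move=> np; elim/big_ind: _ => [|p1 p2|//]; [exact: nonvanish1|exact: nonvanishM].
Qed.

Lemma nonvanish_exp p d : ~ vanish_on X p -> ~ vanish_on X (p ^+ d).
Proof.
move=> np; elim: d => [|d IH]; first by rewrite expr0; exact: nonvanish1.
by rewrite exprS; apply: nonvanishM.
Qed.

Lemma nonvanish_common (I : finType) (p : I -> {mpoly k[N.+1]}) :
  (forall i, ~ vanish_on X (p i)) -> exists2 x, X x & forall i, (p i).@[x 0] != 0.
Proof.
move=> np; have [x Xx] := nonvanish_value (@nonvanish_prod _ (index_enum I) _ np).
rewrite rmorph_prod /= => /prodf_neq0 h; exists x => // i; exact: h.
Qed.

Lemma vanish_cancel p q : ~ vanish_on X q -> vanish_on X (p * q) -> vanish_on X p.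
Proof. by move=> nq pq; apply: NNPP => np; exact: (nonvanishM np nq). Qed.

Lemma dense_open_nonvanish p d : p \is d.-homog -> ~ vanish_on X p ->
  dense_open X (fun x => X x /\ p.@[x 0] != 0).
Proof.
move=> pd np; split.
  exists (fun x => x != 0 /\ p.@[x 0] = 0); first exact: zclosed_form pd.
  move=> x; split=> -[Xx px]; split=> //; first by case=> _ /eqP; rewrite (negPf px).
  by apply/eqP => px0; apply: px; split=> //; exact: variety_neq0.
move=> x Xx Z [S [Sh hZ]] hU; apply/hZ; split; first exact: variety_neq0.
move=> q Sq; have: vanish_on X (q * p).
  move=> y Xy; rewrite mevalM; case: (eqVneq p.@[y 0] 0) => [->|py]; first by rewrite mulr0.
  by have /hZ[_ /(_ q Sq) ->] := hU y (conj Xy py); rewrite mul0r.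
by move/(vanish_cancel np); apply.
Qed.

(** Open sets contain principal open sets, so that density questions become
    questions about a single nonvanishing form. *)
Lemma zopen_form U x : zopen_in X U -> U x ->
  exists p d, [/\ p \is d.-homog, p.@[x 0] != 0 & forall y, X y -> p.@[y 0] != 0 -> U y].
Proof.
case=> Z [S [Sh hZ]] hU /hU[Xx nZx].
have [p Sp px] : exists2 p, S p & p.@[x 0] != 0.
  apply: NNPP => h; apply: nZx; apply/hZ; split; first exact: variety_neq0.
  by move=> p Sp; apply/eqP/negPn/negP => px; apply: h; exists p.
have [d pd] := Sh p Sp; exists p, d; split=> // y Xy py.
by apply/hU; split=> // /hZ[_ /(_ p Sp) py0]; rewrite py0 eqxx in py.
Qed.

Lemma dense_open_form U : dense_open X U ->
  exists p d, [/\ p \is d.-homog, ~ vanish_on X p & forall x, X x -> p.@[x 0] != 0 -> U x].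
Proof.
case=> -[Z Zc hU] Ud; case: X_var => _ [[x0 Xx0] _].
have [x [Xx nZx]] : exists x, X x /\ ~ Z x.
  apply: NNPP => h; have := Ud x0 Xx0 (fun=> False).
  have h1 : zclosed (fun _ : 'rV[k]_N.+1 => False).
    exists (eq 1); split=> [_ <-|x]; first by exists 0%N; exact: dhomog1.
    by split=> // -[_ /(_ _ erefl) /eqP]; rewrite meval1 oner_eq0.
  by move/(_ h1); apply => y /hU h2; apply: h; exists y.
have [p [d [pd px pU]]] := zopen_form (ex_intro2 _ _ Z Zc hU) (proj2 (hU x) (conj Xx nZx)).
by exists p, d; split=> //; exact: value_nonvanish Xx px.
Qed.

(** On the cone over X, the values of all forms of degree d can be scaled
    simultaneously by any c != 0, as c has a d-th root. *)
Lemma cone_root d x (c : k) : (0 < d)%N -> X x -> c != 0 ->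
  exists2 y, X y & forall p, p \is d.-homog -> p.@[y 0] = c * p.@[x 0].
Proof.
move=> d0 Xx c0; have [b bd] := closed_root c d0.
have b0 : b != 0 by apply: contraNneq c0 => b0; rewrite -bd b0 expr0n eqn0Ngt d0.
exists (b *: x); first exact: variety_cone.
move=> p pd; rewrite -bd -(dhomog_scale _ _ pd).
by apply: meval_eq => i; rewrite mxE.
Qed.

End Variety.

(** * General linear combinations generate the function field *)

Section Generic.
Variables (k : closedFieldType) (N r : nat) (X : pset k N).
Hypothesis X_var : projective_variety X.
Hypothesis X_dim : variety_dim X r.
Local Open Scope ring_scope.

(** The exponent D - mdeg m of the new variable is a natural number since D
    exceeds the degree of P. *)
Lemma homogenize_relation n (P : {mpoly k[n]}) : P != 0 ->
  exists2 R : {mpoly k[n.+1]}, R != 0 & exists D, forall y : 'I_n.+1 -> k,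
    y ord0 != 0 -> R.@[y] = y ord0 ^+ D * P.@[fun i => y (lift ord0 i) / y ord0].
Proof.
move=> P0; pose D := msize P.
pose R : {mpoly k[n.+1]} := \sum_(m <- msupp P) P@_m *:
  ('X_ord0 ^+ (D - mdeg m) * \prod_(i < n) 'X_(lift ord0 i) ^+ m i).
have RE y : y ord0 != 0 -> R.@[y] = y ord0 ^+ D * P.@[fun i => y (lift ord0 i) / y ord0].
  move=> y0; rewrite (raddf_sum (meval y)) /= mevalE mulr_sumr big_seq [RHS]big_seq.
  apply: eq_bigr => m mP; rewrite mevalZ mevalM [RHS]mulrCA; congr (_ * _).
  rewrite rmorph_prod rmorphXn /= mevalXU.
  have mD : (mdeg m <= D)%N by rewrite ltnW // msize_mdeg_lt.
  rewrite -{2}(subnK mD) exprD -mulrA; congr (_ * _).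
  rewrite mdegE -prodrXr -big_split; apply: eq_bigr => i _ /=.
  by rewrite rmorphXn /= mevalXU -exprMn mulrCA divff // mulr1.
exists R; last by exists D.
have [v Pv] := mpoly_neq0_value P0.
apply: contraNneq Pv => R0.
pose y i := if unlift ord0 i is Some j then v j else 1.
have y0 : y ord0 = 1 by rewrite /y unlift_none.
have := RE y; rewrite R0 meval0 y0 expr1n mul1r oner_neq0 => /(_ isT) ->.
by apply/eqP/meval_eq => i; rewrite /y liftK divr1.
Qed.

(** The cone over an r-dimensional variety has dimension r + 1: divide by the
    first form to get r + 1 rational functions, and homogenize their relation. *)
Lemma forms_dependent d (g : 'I_r.+2 -> {mpoly k[N.+1]}) :
  (forall i, g i \is d.-homog) ->
  exists2 R : {mpoly k[r.+2]}, R != 0 &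
    forall x, X x -> R.@[fun i => (g i).@[x 0]] = 0.
Proof.
move=> gd; case: (classic (vanish_on X (g ord0))) => [g0|g0].
  exists 'X_ord0 => [|x Xx]; last by rewrite mevalXU g0.
  by rewrite -msize_poly_eq0 msizeX.
have [P0 [P0X P0n]] : exists P : {mpoly k[r.+1]},
    (forall x, X x -> (g ord0).@[x 0] != 0 ->
       P.@[fun i => (g (lift ord0 i)).@[x 0] / (g ord0).@[x 0]] = 0) /\ P <> 0.
  apply: NNPP => h; have [_ /(_ (fun i => (g (lift ord0 i), g ord0)))] := X_dim.
  case=> [i|P hP]; first by split; [exists d; rewrite !gd|].
  apply: NNPP => Pn; apply: h.
  by exists P; split=> // x Xx gx; exact: (hP x Xx (fun=> gx)).
have [R R0 [D RE]] := homogenize_relation (introN eqP P0n).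
exists R => // x Xx; rewrite -(msubst_eval g).
apply: (vanish_cancel X_var g0 _ Xx) => y Xy; rewrite mevalM msubst_eval.
case: (eqVneq (g ord0).@[y 0] 0) => [->|gy]; first by rewrite mulr0.
by rewrite RE // P0X // mulr0 mul0r.
Qed.

Variables (m s d : nat) (a : 'I_m -> 'I_s -> {mpoly k[N.+1]}).
Hypothesis m_ge : (r.+2 <= m)%N.
Hypothesis a_homog : forall l j, a l j \is d.-homog.

(** The coordinates of the space on which the generic relation lives: the
    coefficients of m linear forms, and the m values of these forms. *)
Definition gvar : finType := ('I_m * 'I_s + 'I_m)%type.

Definition gpoint (c : 'I_m * 'I_s -> k) (x : 'rV[k]_N.+1) (i : 'I_#|gvar|) : k :=
  match enum_val i with
  | inl lj => c lj
  | inr l => \sum_j c (l, j) * (a l j).@[x 0]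
  end.

(** The c_lj and the values y_l are m s + m polynomials in the m s functions c_lj
    and the m s functions a_lj.  Among any m s + m of these functions there are
    at least m >= r + 2 of the a_lj, which are dependent on X; so any m s + m of
    them are dependent, and the counting lemma applies. *)
Lemma generic_relation : exists2 f : {mpoly k[#|gvar|]}, f != 0 &
  forall c x, X x -> f.@[gpoint c x] = 0.
Proof.
pose I0 : finType := ('I_m * 'I_s + 'I_m * 'I_s)%type.
pose T := (('I_m * 'I_s -> k) * {x | X x})%type.
pose g (i : 'I_#|I0|) (t : T) : k := match enum_val i with
  | inl lj => t.1 lj
  | inr lj => (a lj.1 lj.2).@[sval t.2 0] end.
pose phi (i : 'I_#|gvar|) : {mpoly k[#|I0|]} := match enum_val i with
  | inl lj => 'X_(enum_rank (inl lj : I0))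
  | inr l => \sum_j 'X_(enum_rank (inl (l, j) : I0)) * 'X_(enum_rank (inr (l, j) : I0)) end.
have cV : #|gvar| = (m * s + m)%N by rewrite card_sum card_prod !card_ord.
have V0 : (0 < #|gvar|)%N by rewrite cV addn_gt0 orbC (leq_trans _ m_ge).
have [J Jc|f [f0 fg]] := @algebraic_dependence_pos k T _ _ g V0 _ phi; last first.
  exists f => // c x Xx; rewrite -(fg (c, exist _ x Xx)); apply: meval_eq => i.
  rewrite /gpoint /phi; case: (enum_val i) => [lj|l].
    by rewrite mevalXU /g enum_rankK.
  rewrite (raddf_sum (meval _)); apply: eq_bigr => j _.
  by rewrite /= mevalM !mevalXU /g !enum_rankK.
(* At most m s indices of J are coefficients; the others select forms a_lj. *)
pose isr (i : 'I_#|I0|) := if enum_val i is inr _ then true else false.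
have Kc : (r.+2 <= #|[set i in J | isr i]|)%N.
  apply: leq_trans m_ge _.
  have := cardsID [set i | isr i] J; rewrite Jc cV => e.
  have le : (#|J :\: [set i | isr i]| <= m * s)%N.
    pose h (lj : 'I_m * 'I_s) := enum_rank (inl lj : I0).
    have /subset_leq_card/leq_trans : J :\: [set i | isr i] \subset h @: [set: 'I_m * 'I_s].
      apply/subsetP => i; rewrite !inE /isr => /andP[]; case E: (enum_val i) => [lj|//] _ _.
      by apply/imsetP; exists lj => //; rewrite /h -E enum_valK.
    by apply; apply: leq_trans (leq_imset_card _ _) _; rewrite cardsT card_prod !card_ord.
  have -> : [set i in J | isr i] = J :&: [set i | isr i] by apply/setP => i; rewrite !inE.
  by rewrite -(leq_add2r (m * s)) addnC -e leq_add2l.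
case/card_geqP: Kc => u [uu us uJ].
have us' : size u == r.+2 by rewrite us.
pose iota := tnth (Tuple us').
have iotau i : iota i \in u by exact: mem_tnth.
pose gg i := if enum_val (iota i) is inr lj then a lj.1 lj.2 else 0.
have [i|R R0 RX] := @forms_dependent d gg.
  by rewrite /gg; case: (enum_val _) => [_|[l j]] /=; rewrite ?a_homog ?rpred0.
exists (msubst (fun i => 'X_(iota i)) R); split.
- have [v Rv] := mpoly_neq0_value R0; apply: contraNneq Rv => R'0.
  pose y j := nth 0 [seq v i | i <- enum 'I_r.+2] (index j u).
  have := msubst_eval (fun i => 'X_(iota i)) R y; rewrite R'0 meval0 => ->.
  apply/eqP/meval_eq => i; rewrite mevalXU /y /iota (tnth_nth (iota i)) /=.
  by rewrite index_uniq ?us // (nth_map i) ?size_enum_ord // nth_ord_enum.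
- move=> m' + i iJ; rewrite /msubst comp_mpolyEX.
  pose P (p : {mpoly k[#|I0|]}) := forall m, m \in msupp p -> m i = 0%N.
  suff : P (\sum_(m0 <- msupp R) R@_m0 *:
     ('X_[m0] \mPo [tuple 'X_(iota i) | i < r.+2])) by apply.
  apply: (big_ind P) => [m0|p1 p2 h1 h2 m0|m0 _ m1]; first by rewrite msupp0.
    by move/msuppD_le; rewrite mem_cat => /orP[/h1|/h2].
  move/msuppZ_le; rewrite comp_mpolyX.
  under eq_bigr do rewrite tnth_mktuple.
  rewrite mprodXnE msuppX inE => /eqP ->; rewrite mnm_sumE big1 // => l _.
  rewrite mulmnE mnm1E; case: eqP => // e.
  by have := uJ _ (iotau l); rewrite inE e (negPf iJ).
move=> t; rewrite msubst_eval -[RHS](RX _ (proj2_sig t.2)); apply: meval_eq => i.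
rewrite mevalXU /g /gg; have := uJ _ (iotau i); rewrite inE /isr => /andP[_].
by case: (enum_val _).
Qed.

(** For a separable relation f, moving c_lj by t moves y_l by t a_lj, and f stays
    zero; so df/dc_lj + a_lj df/dy_l = 0.  If a derivative df/dc_lj is not
    identically zero, neither is df/dy_l, so one may take Q = df/dy_l. *)
Lemma generic_generators : exists l (Q : {mpoly k[#|gvar|]}) (P : 'I_s -> {mpoly k[#|gvar|]}),
  (forall c x, X x -> forall j, (a l j).@[x 0] * Q.@[gpoint c x] = (P j).@[gpoint c x]) /\
  exists c x, X x /\ Q.@[gpoint c x] != 0.
Proof.
have [f f0 fS] := generic_relation.
pose S (v : 'I_#|gvar| -> k) := exists c x, X x /\ v =1 gpoint c x.
have S0 : exists v, S v.
  case: X_var => _ [[x Xx] _]; exists (gpoint (fun=> 0) x), (fun=> 0), x; split=> //.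
have [|f' [i [f'S [v [c [x [Xx vE]]] fi]]]] := separable_relation S0 f0.
  by move=> v [c [x [Xx vE]]]; rewrite (meval_eq _ vE) fS.
have {}f'S c' x' : X x' -> f'.@[gpoint c' x'] = 0.
  by move=> Xx'; apply: f'S; exists c', x'.
have key l j c' x' : X x' ->
    f'^`M(enum_rank (inl (l, j) : gvar)).@[gpoint c' x'] +
    (a l j).@[x' 0] * f'^`M(enum_rank (inr l : gvar)).@[gpoint c' x'] = 0.
  move=> Xx'.
  (* The direction in which gpoint moves when the coefficient c_lj varies. *)
  pose w (i : 'I_#|gvar|) : k := match enum_val i with
    | inl lj => (lj == (l, j))%:R | inr l' => (l' == l)%:R * (a l j).@[x' 0] end.
  have := @dir_deriv_eq0 _ _ f' (gpoint c' x') w.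
  rewrite (bigD1 (enum_rank (inl (l, j) : gvar))) //=.
  rewrite (bigD1 (enum_rank (inr l : gvar))) /=; last first.
    by rewrite (inj_eq enum_rank_inj).
  rewrite big1 /w ?enum_rankK ?eqxx ?mul1r ?addr0.
    apply=> t.
    rewrite -(f'S (fun lj => c' lj + t * (lj == (l, j))%:R) x') //.
    apply: meval_eq => i'; rewrite /gpoint; case: (enum_val i') => // l'.
    under [RHS]eq_bigr do rewrite mulrDl.
    rewrite big_split /=; congr (_ + _).
    rewrite (bigD1 j) //= big1 => [|j' jj']; last first.
      by rewrite xpair_eqE (negPf jj') andbF mulr0 mul0r.
    rewrite xpair_eqE eqxx andbT addr0 mulrA; case: eqP => [->|_] //.
    by rewrite !mulr0 !mul0r.
  move=> i' /andP[n1 n2]; have := enum_valK i'.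
  case E: (enum_val i') => [lj|l'] e.
    case: eqP => [e'|_]; last by rewrite mul0r.
    by rewrite -e e' eqxx in n1.
  case: eqP => [e'|_]; last by rewrite !mul0r.
  by rewrite -e e' eqxx in n2.
(* The derivative that does not vanish may be one with respect to c_lj. *)
have [l hl] : exists l, f'^`M(enum_rank (inr l : gvar)).@[gpoint c x] != 0.
  move: fi; rewrite (meval_eq _ vE) -(enum_valK i); case: (enum_val i) => [[l j]|l] h.
    exists l; apply: contraNneq h => h; have := key l j c x Xx.
    by rewrite h mulr0 addr0 => ->.
  by exists l.
exists l, f'^`M(enum_rank (inr l : gvar)), (fun j => - f'^`M(enum_rank (inl (l, j) : gvar))).
split; last by exists c, x.
move=> c' x' Xx' j; rewrite mevalN; apply/eqP; rewrite -addr_eq0 addrC.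
by rewrite key.
Qed.

End Generic.

(** * Tuples of forms that generate the function field *)

Section Generators.
Variables (k : closedFieldType) (N r d : nat) (X : pset k N).
Hypothesis X_var : projective_variety X.
Local Open Scope ring_scope.

Definition tuple_at m (Y : 'I_m -> {mpoly k[N.+1]}) (x : 'rV[k]_N.+1) : 'I_m -> k :=
  fun l => (Y l).@[x 0].

(** On X, h is the value at the tuple Y of the rational function P / Q, which is
    homogeneous of degree one when Q has degree e. *)
Definition expresses m (Y : 'I_m -> {mpoly k[N.+1]}) e (Q : {mpoly k[m]})
    (h : {mpoly k[N.+1]}) (P : {mpoly k[m]}) :=
  P \is e.+1.-homog /\
  forall x, X x -> h.@[x 0] * Q.@[tuple_at Y x] = P.@[tuple_at Y x].

(** All forms of degree d are rational functions of the tuple Y, with a common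
    denominator.  When d > 0 and the Y l have degree d themselves, their ratios
    then generate the function field of X. *)
Definition generates m (Y : 'I_m -> {mpoly k[N.+1]}) := exists e Q,
  [/\ Q \is e.-homog, ~ vanish_on X (msubst Y Q) &
      forall h, h \is d.-homog -> exists P, expresses Y e Q h P].

(** Scaling the point multiplies Y and a by the same factor, so the relation
    a j * Q(Y) = P j (Y) splits into homogeneous pieces.  The degree d must be
    positive for the factor to be arbitrary. *)
Lemma homogenize_expression m s (Y : 'I_m -> {mpoly k[N.+1]})
    (a : 'I_s -> {mpoly k[N.+1]}) (Q : {mpoly k[m]}) (P : 'I_s -> {mpoly k[m]}) :
  (0 < d)%N -> (forall l, Y l \is d.-homog) -> (forall j, a j \is d.-homog) ->
  (forall x, X x -> forall j, (a j).@[x 0] * Q.@[tuple_at Y x] = (P j).@[tuple_at Y x]) ->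
  ~ vanish_on X (msubst Y Q) ->
  exists e Q', [/\ Q' \is e.-homog, ~ vanish_on X (msubst Y Q') &
    forall j, exists P', expresses Y e Q' (a j) P'].
Proof.
move=> d0 Yd ad rel /nonvanish_value[x0 Xx0]; rewrite msubst_eval => Qx0.
have [e Qe] : exists e, (pihomog mdeg e Q).@[tuple_at Y x0] != 0.
  apply: NNPP => h; case/eqP: Qx0.
  rewrite [Q](pihomog_partitionE (leqnn (msize Q))) raddf_sum big1 // => e _.
  by apply/eqP/negPn/negP => he; apply: h; exists (e : nat).
exists e, (pihomog mdeg e Q); split; first exact: pihomogP.
  by apply: (value_nonvanish Xx0); rewrite msubst_eval.
move=> j; exists (pihomog mdeg e.+1 (P j)); split=> [|x Xx]; first exact: pihomogP.
have : 'X * ((a j).@[x 0] *: ray Q (tuple_at Y x)) - ray (P j) (tuple_at Y x) = 0.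
  apply: poly_eq0_of_values => c c0; have [y Xy yE] := cone_root X_var d0 Xx c0.
  have Yy : tuple_at Y y =1 (fun l => c * tuple_at Y x l) by move=> l; apply: yE.
  have := rel y Xy j; rewrite yE // (meval_eq _ Yy) (meval_eq (P j) Yy) -!horner_ray => e1.
  by rewrite hornerD hornerN hornerM hornerX hornerZ mulrA e1 subrr.
move/(congr1 (fun p : {poly k} => p`_e.+1)).
rewrite coefB coefXM /= coefZ !coef_ray coef0 => /eqP.
by rewrite subr_eq0 => /eqP.
Qed.

(** If G inverts A, then G(A(x)) = c x for some scalar c.  Evaluated there, h and
    A j0 are both multiplied by c^d, so h / A j0 equals the quotient of h(G) and
    (A j0)(G), evaluated at A(x). *)
Lemma generates_of_inverse m (A : 'I_m -> {mpoly k[N.+1]}) g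
    (G : 'I_N.+1 -> {mpoly k[m]}) i0 j0 :
  (forall j, A j \is d.-homog) -> (forall i, G i \is g.-homog) ->
  (forall x, X x -> forall i j,
     (G i).@[tuple_at A x] * x 0 j = (G j).@[tuple_at A x] * x 0 i) ->
  ~ vanish_on X (msubst A (G i0)) -> ~ vanish_on X (A j0) ->
  generates A.
Proof.
move=> Ad Gg inv nG nA.
have scale x : X x -> exists c, (forall p e, p \is e.-homog ->
    (msubst G p).@[tuple_at A x] = c ^+ e * p.@[x 0]) /\
    (forall i, (G i).@[tuple_at A x] = c * x 0 i).
  move=> Xx; have := variety_neq0 X_var Xx => /rV0Pn[i xi].
  have GE j : (G j).@[tuple_at A x] = (G i).@[tuple_at A x] / x 0 i * x 0 j.
    by rewrite mulrAC inv // mulfK.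
  exists ((G i).@[tuple_at A x] / x 0 i); split=> // p e pe.
  by rewrite msubst_eval -(dhomog_scale _ _ pe); apply: meval_eq.
exists (g * d)%N, (msubst G (A j0)); split; first exact: msubst_homog.
  have [x Xx []] := variety_prime X_var nG nA; rewrite msubst_eval => Gx Ax.
  apply: (value_nonvanish Xx); rewrite msubst_eval.
  have [c [cE Gc]] := scale x Xx; rewrite -/(tuple_at A x) (cE _ _ (Ad j0)) mulf_neq0 //.
  by rewrite expf_neq0 //; apply: contraNneq Gx => c0; rewrite -/(tuple_at A x) Gc c0 mul0r.
move=> h hd; exists ('X_j0 * msubst G h); split.
  rewrite -[(g * d).+1]add1n; apply: dhomogM; last exact: msubst_homog.
  by rewrite dhomogX /= mdeg1.
move=> x Xx; have [c [cE _]] := scale x Xx.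
by rewrite mevalM mevalXU (cE _ _ hd) (cE _ _ (Ad j0)) mulrC -mulrA mulrCA mulrA [_ * h.@[_]]mulrC.
Qed.

(** Substituting P j / Q for a j in a quotient V / W of forms of degrees w + 1 and
    w gives V(P) / (Q W(P)). *)
Lemma generates_trans m s (Y : 'I_m -> {mpoly k[N.+1]}) (a : 'I_s -> {mpoly k[N.+1]}) e Q :
  Q \is e.-homog -> ~ vanish_on X (msubst Y Q) ->
  (forall j, exists P, expresses Y e Q (a j) P) ->
  generates a -> generates Y.
Proof.
move=> Qe nQ /fin_all_exists[P hP] [w [W [Ww nW gW]]].
have Pe j : P j \is e.+1.-homog by case: (hP j).
have PE x : X x -> forall j, (P j).@[tuple_at Y x] = Q.@[tuple_at Y x] * (a j).@[x 0].
  by move=> Xx j; case: (hP j) => _ <- //; rewrite mulrC.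
have VE x (V : {mpoly k[s]}) v : X x -> V \is v.-homog ->
    (msubst P V).@[tuple_at Y x] = Q.@[tuple_at Y x] ^+ v * V.@[tuple_at a x].
  move=> Xx Vv; rewrite msubst_eval -(dhomog_scale _ _ Vv).
  by apply: meval_eq => j; rewrite PE.
exists (e + e.+1 * w)%N, (Q * msubst P W); split.
- by apply: dhomogM => //; apply: msubst_homog.
- have [x Xx []] := variety_prime X_var nQ nW; rewrite !msubst_eval => Qx Wx.
  apply: (value_nonvanish Xx); rewrite msubst_eval mevalM -/(tuple_at Y x) (VE _ _ _ Xx Ww).
  by rewrite !mulf_neq0 // expf_neq0.
move=> h hd; have [V [Vw VW]] := gW h hd; exists (msubst P V); split.
  have := msubst_homog Vw Pe; suff -> : (e.+1 * w.+1 = (e + e.+1 * w).+1)%N by [].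
  by rewrite mulnS addSn.
move=> x Xx; rewrite mevalM (VE _ _ _ Xx Ww) (VE _ _ _ Xx Vw) -VW // exprS.
by ring.
Qed.

Hypothesis X_dim : variety_dim X r.
Hypothesis d_gt0 : (0 < d)%N.

Section Chain.
Variables (n : nat) (A B : 'I_n.+1 -> {mpoly k[N.+1]}).
Hypotheses (n_ge : (r.+2 <= n)%N) (A_homog : forall j, A j \is d.-homog)
  (B_homog : forall j, B j \is d.-homog) (A_gen : generates A) (B_gen : generates B).

Definition chain (cA cB : 'M[k]_n.+1) (i : nat) (l : 'I_n.+1) : {mpoly k[N.+1]} :=
  if (l < i)%N then \sum_j cA l j *: A j else \sum_j cB l j *: B j.

(** Each position i of the chain has its own generic denominator, a nonzero
    polynomial function of the coefficients and the point.  First choose a point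
    x good for all i, by irreducibility of X; at that point the denominators and
    the two determinants are finitely many nonzero polynomials in the
    coefficients, so some coefficients avoid all their zeros. *)
Lemma chain_generates : exists cA cB : 'M[k]_n.+1, [/\ \det cA != 0, \det cB != 0 &
  forall i : 'I_n.+1, generates (fun l => chain cA cB i (lift i l))].
Proof.
pose W : finType := (bool * 'I_n.+1 * 'I_n.+1)%type.
pose bi (i : 'I_n.+1) (l : 'I_n) := (lift i l < i)%N.
pose a i l (j : 'I_n.+1) := if bi i l then A j else B j.
have ad i l j : a i l j \is d.-homog by rewrite /a; case: ifP.
pose V : finType := gvar n n.+1.
have h (i : 'I_n.+1) : exists D : 'I_n * {mpoly k[#|V|]} * ('I_n.+1 -> {mpoly k[#|V|]}),
    (forall c x, X x -> forall j, (a i D.1.1 j).@[x 0] * D.1.2.@[gpoint (a i) c x] =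
       (D.2 j).@[gpoint (a i) c x]) /\
    exists c x, X x /\ D.1.2.@[gpoint (a i) c x] != 0.
  have [l [Q [P [h1 h2]]]] := generic_generators X_var X_dim n_ge (ad i).
  by exists (l, Q, P).
have {h} [D hD] := fin_all_exists h.
have {hD} [DE Dn] := all_and2 hD.
have {Dn} [c hc] := fin_all_exists Dn.
(* The i-th denominator as a polynomial in the point, for its own coefficients. *)
pose px i : {mpoly k[N.+1]} := msubst (fun t : 'I_#|V| => match enum_val t with
  | inl lj => (c i lj)%:MP | inr l => \sum_j c i (l, j) *: a i l j end) (D i).1.2.
have pxE i (x : 'rV[k]_N.+1) : (px i).@[x 0] = (D i).1.2.@[gpoint (a i) (c i) x].
  rewrite msubst_eval; apply: meval_eq => t; rewrite /gpoint.
  case: (enum_val t) => [lj|l]; first by rewrite mevalC.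
  by rewrite raddf_sum; apply: eq_bigr => j _; rewrite /= mevalZ.
have [x Xx hx] : exists2 x, X x & forall i, (px i).@[x 0] != 0.
  apply: (nonvanish_common X_var) => i; have [x [Xx hx]] := hc i.
  by apply: (value_nonvanish Xx); rewrite pxE.
pose cw (w : W -> k) i (lj : 'I_n * 'I_n.+1) := w (bi i lj.1, lift i lj.1, lj.2).
(* The i-th denominator as a polynomial in the common coefficients, at x. *)
pose pw i : {mpoly k[#|W|]} := msubst (fun t : 'I_#|V| => match enum_val t with
  | inl lj => 'X_(enum_rank ((bi i lj.1, lift i lj.1, lj.2) : W))
  | inr l => \sum_j (a i l j).@[x 0] *: 'X_(enum_rank ((bi i l, lift i l, j) : W)) end) (D i).1.2.
have pwE i (w : W -> k) : (pw i).@[fun t => w (enum_val t)] = (D i).1.2.@[gpoint (a i) (cw w i) x].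
  rewrite msubst_eval; apply: meval_eq => t; rewrite /gpoint.
  case: (enum_val t) => [lj|l]; first by rewrite mevalXU enum_rankK.
  rewrite raddf_sum; apply: eq_bigr => j _.
  by rewrite /= mevalZ mevalXU enum_rankK mulrC.
have pw0 i : pw i != 0.
  pose w (u : W) := if unlift i u.1.2 is Some l then c i (l, u.2) else 0.
  apply: contraNneq (hx i) => p0; have := pwE i w.
  rewrite p0 meval0 pxE => ->; apply/eqP/meval_eq => t; rewrite /gpoint.
  case: (enum_val t) => [[l j]|l]; first by rewrite /cw /w /= liftK.
  by apply: eq_bigr => j _; rewrite /cw /w /= liftK.
(* b tells the coefficients of the A j from those of the B j. *)
pose dt b : {mpoly k[#|W|]} := \det (\matrix_(l, j) 'X_(enum_rank ((b, l, j) : W))).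
have dtE b (w : W -> k) : (dt b).@[fun t => w (enum_val t)] = \det (\matrix_(l, j) w (b, l, j)).
  rewrite /dt -det_map_mx; congr (\det _); apply/matrixP => l j.
  by rewrite !mxE /= mevalXU enum_rankK.
have dt0 b : dt b != 0.
  apply/eqP => p0; have := dtE b (fun u => (u.1.2 == u.2)%:R); rewrite p0 meval0.
  rewrite (_ : \matrix_(l, j) _ = 1%:M) ?det1; first by move/esym/eqP; rewrite oner_eq0.
  by apply/matrixP => l j; rewrite !mxE.
have [v] : exists v, (dt true * dt false * \prod_i pw i).@[v] != 0.
  by apply: mpoly_neq0_value; rewrite !mulf_neq0 //; apply/prodf_neq0.
pose w (u : W) := v (enum_rank u).
have vw : v =1 (fun t => w (enum_val t)) by move=> t; rewrite /w enum_valK.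
rewrite (meval_eq _ vw) !mevalM !dtE rmorph_prod /= !mulf_eq0 !negb_or => /andP[/andP[d1 d2]].
move/prodf_neq0 => wp.
exists (\matrix_(l, j) w (true, l, j)), (\matrix_(l, j) w (false, l, j)); split=> // i.
set Y := fun l => _.
have YE l (y : 'rV[k]_N.+1) : (Y l).@[y 0] = \sum_j cw w i (l, j) * (a i l j).@[y 0].
  rewrite /Y /chain /cw /a /bi; case: ifP => _; rewrite raddf_sum; apply: eq_bigr => j _;
  by rewrite /= mevalZ mxE.
have Yd l : Y l \is d.-homog.
  by rewrite /Y /chain; case: ifP => _; apply: rpred_sum => j _; apply: rpredZ.
(* Specialization of the coefficients to the values chosen. *)
pose sp (p : {mpoly k[#|V|]}) : {mpoly k[n]} := msubst (fun t : 'I_#|V| =>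
  match enum_val t with inl lj => (cw w i lj)%:MP | inr l => 'X_l end) p.
have spE p (y : 'rV[k]_N.+1) : (sp p).@[tuple_at Y y] = p.@[gpoint (a i) (cw w i) y].
  rewrite msubst_eval; apply: meval_eq => t; rewrite /gpoint.
  by case: (enum_val t) => [lj|l]; rewrite ?mevalC // mevalXU /tuple_at YE.
have [e [Q [Qe nQ QP]]] : exists e Q', [/\ Q' \is e.-homog, ~ vanish_on X (msubst Y Q') &
    forall j, exists P', expresses Y e Q' (a i (D i).1.1 j) P'].
  apply: (homogenize_expression (Q := sp (D i).1.2) (P := fun j => sp ((D i).2 j))) => //.
    by move=> y Xy j; rewrite !spE DE.
  by apply: (value_nonvanish Xx); rewrite msubst_eval spE -pwE wp.
apply: (generates_trans Qe nQ QP).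
by rewrite /a; case: (bi i _).
Qed.

End Chain.
End Generators.

(** * Tuples linked by birational maps of projective space *)

Section Links.
Variables (k : closedFieldType) (N n : nat) (X : pset k N).
Hypothesis X_var : projective_variety X.
Local Open Scope ring_scope.
Local Notation tuple := ('I_n.+1 -> {mpoly k[N.+1]}).
Local Notation endo := (forms k n n).

(** The forms F send the tuple Y to Z up to a common factor on X, and F' undoes F
    as a polynomial identity, up to a factor H.  Since H does not vanish
    identically along Y, it is not the zero polynomial. *)
Definition carries (Y Z : tuple) (F F' : endo) := [/\
  exists e, forall i, F i \is e.-homog,
  exists h H, [/\ H \is h.-homog, ~ vanish_on X (msubst Y H) &
    forall y i, (F' i).@[fun l => (F l).@[y]] = H.@[y] * y i] &
  exists2 M, ~ vanish_on X M &
    forall x, X x -> forall i, (F i).@[tuple_at Y x] = M.@[x 0] * (Z i).@[x 0]].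

Definition linked (Y Z : tuple) := exists F F', carries Y Z F F' /\ carries Z Y F' F.

Lemma linked_sym Y Z : linked Y Z -> linked Z Y.
Proof. by case=> F [F' [h1 h2]]; exists F', F. Qed.

Lemma carries_trans Y Z V F1 F1' F2 F2' e' : (forall i, F1' i \is e'.-homog) ->
  carries Y Z F1 F1' -> carries Z V F2 F2' ->
  carries Y V (fun i => msubst F1 (F2 i)) (fun i => msubst F2' (F1' i)).
Proof.
move=> e'F1' [[e1 F1e] [h1 [H1 [H1h nH1 FF1]]] [M1 nM1 FM1]].
move=> [[e2 F2e] [h2 [H2 [H2h nH2 FF2]]] [M2 nM2 FM2]].
have scaled x p e : X x -> p \is e.-homog ->
    p.@[fun l => (F1 l).@[tuple_at Y x]] = M1.@[x 0] ^+ e * p.@[tuple_at Z x].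
  by move=> Xx pe; rewrite -(dhomog_scale _ _ pe); apply: meval_eq => l; exact: FM1.
split.
- by exists (e1 * e2)%N => i; apply: msubst_homog.
- exists (e1 * h2 * e' + h1)%N, (msubst F1 H2 ^+ e' * H1); split.
  + by apply: dhomogM => //; apply: dhomogMn; apply: msubst_homog.
  + have [x Xx []] := variety_prime X_var (nonvanishM X_var nM1 nH1) nH2.
    rewrite mevalM mulf_eq0 negb_or => /andP[M1x]; rewrite !msubst_eval => H1x H2x.
    apply: (value_nonvanish Xx); rewrite msubst_eval mevalM rmorphXn /= msubst_eval.
    by rewrite (scaled _ _ _ Xx H2h) !(mulf_neq0, expf_neq0).
  + move=> y i; rewrite msubst_eval mevalM rmorphXn /= msubst_eval -mulrA -FF1.
    rewrite -(dhomog_scale _ _ (e'F1' i)); apply: meval_eq => l; rewrite -FF2.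
    by apply: meval_eq => l'; rewrite msubst_eval.
- exists (M1 ^+ e2 * M2).
    by apply: nonvanishM => //; apply: nonvanish_exp.
  move=> x Xx i; rewrite msubst_eval (scaled _ _ _ Xx (F2e i)) FM2 //.
  by rewrite mevalM rmorphXn /= mulrA.
Qed.

Lemma linked_trans Y Z V : linked Y Z -> linked Z V -> linked Y V.
Proof.
move=> [F1 [F1' [h1 h1']]] [F2 [F2' [h2 h2']]].
exists (fun i => msubst F1 (F2 i)), (fun i => msubst F2' (F1' i)).
case: (h1') (h2) => [[e1 e1F] _ _] [[e2 e2F] _ _].
by split; [apply: (carries_trans e1F h1 h2) | apply: (carries_trans e2F h2' h1')].
Qed.

Lemma carries_linear (Y Z : tuple) (C C' : 'M[k]_n.+1) : C' *m C = 1%:M ->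
  (forall x, X x -> forall l, (Z l).@[x 0] = \sum_j C l j * (Y j).@[x 0]) ->
  carries Y Z (fun l => \sum_j C l j *: 'X_j) (fun l => \sum_j C' l j *: 'X_j).
Proof.
move=> CC ZY.
have linE (D : 'M[k]_n.+1) l y : (\sum_j D l j *: 'X_j).@[y] = \sum_j D l j * y j.
  by rewrite raddf_sum; apply: eq_bigr => j _; rewrite /= mevalZ mevalXU.
split.
- exists 1%N => l; apply: rpred_sum => j _; apply: rpredZ.
  by rewrite dhomogX /= mdeg1.
- exists 0%N, 1; split; first exact: dhomog1.
    by rewrite /msubst rmorph1; exact: nonvanish1.
  move=> y i; rewrite linE meval1 mul1r.
  under eq_bigr do rewrite linE mulr_sumr.
  rewrite exchange_big (bigD1 i) //= [X in _ + X]big1 => [|j ji].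
    have /matrixP/(_ i i) := CC; rewrite !mxE eqxx mulr1n => e.
    rewrite addr0 -[RHS]mul1r -e mulr_suml.
    by under [RHS]eq_bigr do rewrite -mulrA.
  have /matrixP/(_ i j) := CC; rewrite !mxE eq_sym (negPf ji) => e.
  under eq_bigr do rewrite mulrA.
  by rewrite -mulr_suml e mul0r.
exists 1 => [|x Xx l]; first exact: nonvanish1.
by rewrite linE meval1 mul1r ZY.
Qed.

Lemma linked_linear (Y Z : tuple) (C : 'M[k]_n.+1) : \det C != 0 ->
  (forall x, X x -> forall l, (Z l).@[x 0] = \sum_j C l j * (Y j).@[x 0]) ->
  linked Y Z.
Proof.
move=> dC ZY; have uC : C \in unitmx by rewrite unitmxE unitfE.
exists (fun l => \sum_j C l j *: 'X_j), (fun l => \sum_j invmx C l j *: 'X_j).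
split; apply: carries_linear; rewrite ?mulVmx ?mulmxV // => x Xx l.
under eq_bigr do rewrite ZY // mulr_sumr.
rewrite exchange_big (bigD1 l) //= [X in _ + X]big1 => [|j jl].
  have /matrixP/(_ l l) := mulVmx uC; rewrite !mxE eqxx mulr1n => e.
  rewrite addr0 -[LHS]mul1r -e mulr_suml.
  by apply: eq_bigr => j _; rewrite mulrA.
have /matrixP/(_ l j) := mulVmx uC; rewrite !mxE eq_sym (negPf jl) => e.
under eq_bigr do rewrite mulrA.
by rewrite -mulr_suml e mul0r.
Qed.

(** The map y_i |-> y_i + P / Q fixing the other coordinates, multiplied by the
    denominator Q, where P and Q are forms in the coordinates other than y_i. *)
Definition de_jonquieres (i : 'I_n.+1) (Q P : {mpoly k[n]}) : endo := fun l =>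
  'X_l * msubst (fun j => 'X_(lift i j)) Q +
  (if l == i then msubst (fun j => 'X_(lift i j)) P else 0).

Lemma de_jonquieresE i Q P y l : (de_jonquieres i Q P l).@[y] =
  y l * Q.@[fun j => y (lift i j)] + (if l == i then P.@[fun j => y (lift i j)] else 0).
Proof.
have E (p : {mpoly k[n]}) : (msubst (fun j => 'X_(lift i j)) p).@[y] = p.@[fun j => y (lift i j)].
  by rewrite msubst_eval; apply: meval_eq => j; rewrite mevalXU.
rewrite mevalD mevalM mevalXU E; congr (_ + _).
by case: ifP; rewrite ?meval0.
Qed.

(** Writing Q and P for their values at y, the new shared coordinates are Q times
    the old ones, so that Q becomes Q^(e+1) and P becomes Q^(e+1) P; composing with
    the map for -P multiplies everything by Q^(e+2). *)
Lemma carries_de_jonquieres i e (Q P : {mpoly k[n]}) (Y Z : tuple) :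
  Q \is e.-homog -> P \is e.+1.-homog ->
  (forall l, Y (lift i l) = Z (lift i l)) ->
  ~ vanish_on X (msubst (fun l => Y (lift i l)) Q) ->
  (forall x, X x -> ((Z i).@[x 0] - (Y i).@[x 0]) * Q.@[tuple_at (fun l => Y (lift i l)) x] =
     P.@[tuple_at (fun l => Y (lift i l)) x]) ->
  carries Y Z (de_jonquieres i Q P) (de_jonquieres i Q (- P)).
Proof.
move=> Qe Pe YZ nQ ZYP.
have X1 (l : 'I_n.+1) : ('X_l : {mpoly k[n.+1]}) \is 1.-homog by rewrite dhomogX /= mdeg1.
have Qh : msubst (fun j => 'X_(lift i j)) Q \is e.-homog.
  by rewrite -[e]mul1n; apply: msubst_homog.
split.
- exists e.+1 => l; rewrite rpredD //; first by rewrite -[e.+1]add1n dhomogM.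
  by case: ifP => _; rewrite ?rpred0 // -[e.+1]mul1n; apply: msubst_homog.
- exists (e * e.+2)%N, (msubst (fun j => 'X_(lift i j)) Q ^+ e.+2); split.
  + exact: dhomogMn.
  + rewrite /msubst rmorphXn /=; apply: nonvanish_exp => // h; apply: nQ => x Xx.
    rewrite -[RHS](h x Xx) !msubst_eval; apply: meval_eq => l.
    by rewrite mevalXU.
  move=> y j; pose q := Q.@[fun j => y (lift i j)].
  have qE : (msubst (fun j => 'X_(lift i j)) Q).@[y] = q.
    by rewrite msubst_eval; apply: meval_eq => l; rewrite mevalXU.
  have sc p d : p \is d.-homog ->
      p.@[fun l => (de_jonquieres i Q P (lift i l)).@[y]] = q ^+ d * p.@[fun j => y (lift i j)].
    move=> pd; rewrite -(dhomog_scale _ _ pd); apply: meval_eq => l.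
    by rewrite de_jonquieresE eq_sym (negPf (neq_lift i l)) addr0 mulrC.
  rewrite !de_jonquieresE rmorphXn /= qE mevalN (sc _ _ Qe) (sc _ _ Pe) -/q !exprS.
  by case: ifP => _; ring.
exists (msubst (fun l => Y (lift i l)) Q) => // x Xx l; rewrite de_jonquieresE msubst_eval.
case: eqP => [->|/eqP]; first by rewrite -ZYP // /tuple_at; ring.
rewrite eq_sym => /unlift_some[l' -> _]; by rewrite addr0 mulrC /tuple_at YZ.
Qed.

Lemma linked_de_jonquieres i d (Y Z : tuple) :
  (forall l, Y l \is d.-homog) -> (forall l, Z l \is d.-homog) ->
  (forall l, Y (lift i l) = Z (lift i l)) ->
  generates d X (fun l => Y (lift i l)) -> linked Y Z.
Proof.
move=> Yd Zd YZ [e [Q [Qe nQ gQ]]].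
have [|P [Pe PE]] := gQ (Z i - Y i); first by apply: rpredB; [exact: Zd | exact: Yd].
have ZYP x : X x -> ((Z i).@[x 0] - (Y i).@[x 0]) * Q.@[tuple_at (fun l => Y (lift i l)) x] =
     P.@[tuple_at (fun l => Y (lift i l)) x].
  by move=> Xx; rewrite -mevalB PE.
exists (de_jonquieres i Q P), (de_jonquieres i Q (- P)).
split; first by apply: (carries_de_jonquieres Qe Pe).
have YZx x : tuple_at (fun l => Z (lift i l)) x =1 tuple_at (fun l => Y (lift i l)) x.
  by move=> l; rewrite /tuple_at YZ.
rewrite -[in X in carries _ _ _ X](opprK P).
apply: (carries_de_jonquieres Qe) => //; first by rewrite rpredN.
  move=> h; apply: nQ => x Xx; rewrite -[RHS](h x Xx) !msubst_eval.
  by apply: meval_eq => l; rewrite YZ.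
move=> x Xx; rewrite !(meval_eq _ (YZx x)) mevalN -ZYP //.
by ring.
Qed.

Lemma generating_tuples_linked r d (A B : tuple) :
  variety_dim X r -> (0 < d)%N -> (r.+2 <= n)%N ->
  (forall j, A j \is d.-homog) -> (forall j, B j \is d.-homog) ->
  generates d X A -> generates d X B -> linked B A.
Proof.
move=> X_dim d0 rn Ad Bd gA gB.
have [cA [cB [dA dB gen]]] := chain_generates X_var X_dim d0 rn Ad Bd gA gB.
pose Y i := chain A B cA cB i.
have Yd i l : Y i l \is d.-homog.
  by rewrite /Y /chain; case: ifP => _; apply: rpred_sum => j _; apply: rpredZ.
have sumE (c : 'I_n.+1 -> k) (Z : tuple) (x : 'rV[k]_N.+1) :
    (\sum_j c j *: Z j).@[x 0] = \sum_j c j * (Z j).@[x 0].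
  by rewrite raddf_sum; apply: eq_bigr => j _; rewrite /= mevalZ.
have B0 : linked B (Y 0%N) by apply: (linked_linear dB) => x _ l; rewrite sumE.
have An : linked A (Y n.+1).
  by apply: (linked_linear dA) => x _ l; rewrite /Y /chain ltn_ord sumE.
apply: linked_trans (linked_sym An).
suff : forall i, (i <= n.+1)%N -> linked B (Y i) by apply.
elim=> // i IH ltin; apply: linked_trans (IH (ltnW ltin)) _.
apply: (@linked_de_jonquieres (Ordinal ltin) d) => // [l|]; last exact: gen.
have ne : (lift (Ordinal ltin) l == i :> nat) = false.
  by apply/negbTE; rewrite eq_sym; exact: neq_lift.
have e : (lift (Ordinal ltin) l < i.+1)%N = (lift (Ordinal ltin) l < i)%N.
  by rewrite ltnS leq_eqVlt ne.
by rewrite /Y /chain e.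
Qed.

End Links.

(** * Linear systems and their maps *)

Section ProjectiveSpace.
Variables (k : closedFieldType) (n : nat).
Local Open Scope ring_scope.
Implicit Types (p q : {mpoly k[n.+1]}).

(** The zero vector is not a point; multiplying by a coordinate before choosing a
    value keeps away from it. *)
Lemma pspace_nonvanish p : p != 0 -> ~ vanish_on (@pspace k n) p.
Proof.
move=> p0; have : p * 'X_ord0 != 0 by rewrite mulf_neq0 // -msize_poly_eq0 msizeX.
case/mpoly_neq0_value => v; rewrite mevalM mulf_eq0 negb_or mevalXU => /andP[pv v0].
move=> /(_ (\row_i v i)) h; case/eqP: pv; rewrite -h.
  by apply: meval_eq => i; rewrite mxE.
by apply/rV0Pn; exists ord0; rewrite mxE.
Qed.

Lemma zclosed_pspace : zclosed (@pspace k n).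
Proof.
by exists (fun=> False); split=> // x; split=> [|[]].
Qed.

Lemma pspace_variety : projective_variety (@pspace k n).
Proof.
split; first exact: zclosed_pspace.
have [x0 x0n] : exists x, @pspace k n x.
  exists (\row_i 1); apply/rV0Pn; exists ord0; by rewrite mxE oner_neq0.
split; first by exists x0.
have separate Z : zclosed Z -> ~ (forall x, pspace x -> Z x) ->
    exists2 p : {mpoly k[n.+1]}, p != 0 & forall x, Z x -> p.@[x 0] = 0.
  case=> S [Sh hZ] nZ; apply: NNPP => h; apply: nZ => x xn; apply/hZ; split=> // p Sp.
  case: (eqVneq p 0) => [->|p0]; first by rewrite meval0.
  by case: h; exists p => // y /hZ[_]; apply.
move=> Z1 Z2 c1 c2 cover; apply: NNPP => /not_or_and[n1 n2].
have [p1 p10 h1] := separate Z1 c1 n1; have [p2 p20 h2] := separate Z2 c2 n2.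
apply: (pspace_nonvanish (mulf_neq0 p10 p20)) => x /cover[/h1|/h2] e.
  by rewrite mevalM e mul0r.
by rewrite mevalM e mulr0.
Qed.

Lemma rmap_value (F : forms k n n) (y : 'rV[k]_n.+1) : rational_map (@pspace k n) F ->
  y != 0 -> (\row_i (F i).@[y 0]) != 0 ->
  rmap (@pspace k n) F y (\row_i (F i).@[y 0]).
Proof.
move=> rF y0 Fy; split=> //; exists F; split=> //.
  by move=> i j x _; rewrite subrr meval0.
by split=> //; exists 1; rewrite scale1r.
Qed.

Lemma rmap_inverse (F F' : forms k n n) h (H : {mpoly k[n.+1]}) :
  rational_map (@pspace k n) F -> rational_map (@pspace k n) F' ->
  H \is h.-homog -> H != 0 ->
  (forall y i, (F' i).@[fun l => (F l).@[y]] = H.@[y] * y i) ->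
  pmap_eq (@pspace k n) (Defs.pcomp (rmap (@pspace k n) F) (rmap (@pspace k n) F')) (@same_pt k n).
Proof.
move=> rF rF' Hh H0 inv; case: (rF) => [[e Fe] [i0 nF]].
have HF : H * F i0 \is (h + e).-homog by exact: dhomogM.
have nHF := nonvanishM pspace_variety (pspace_nonvanish H0) nF.
exists (fun x => pspace x /\ (H * F i0).@[x 0] != 0).
  exact: (dense_open_nonvanish pspace_variety HF nHF).
move=> x [x0]; rewrite mevalM mulf_eq0 negb_or => /andP[Hx Fx].
pose z : 'rV[k]_n.+1 := \row_i (F i).@[x 0].
have z0 : z != 0 by apply/rV0Pn; exists i0; rewrite mxE.
have zE i : (F' i).@[z 0] = H.@[x 0] * x 0 i.
  by rewrite -inv; apply: meval_eq => l; rewrite mxE.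
have z'E : \row_i (F' i).@[z 0] = H.@[x 0] *: x.
  by apply/rowP => i; rewrite !mxE zE.
have z'0 : \row_i (F' i).@[z 0] != 0 by rewrite z'E scaler_eq0 negb_or Hx.
exists (\row_i (F' i).@[z 0]); first by exists z; [exact: rmap_value|exact: rmap_value].
by split=> //; exists H.@[x 0].
Qed.

End ProjectiveSpace.

Section LinearSystems.
Variables (k : closedFieldType) (N : nat) (X : pset k N).
Hypothesis X_var : projective_variety X.
Local Open Scope ring_scope.

Lemma common_denominator (I : finType) (f : I -> fraction k N) :
  (forall i, ratfun X (f i)) ->
  exists (d : nat) (A : I -> {mpoly k[N.+1]}),
    [/\ \prod_i (f i).2 \is d.-homog, ~ vanish_on X (\prod_i (f i).2),
        forall i, A i \is d.-homog &
        forall i, A i * (f i).2 = (f i).1 * \prod_i (f i).2].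
Proof.
move=> rf; have [|dg hdg] := @fin_all_exists I (fun=> nat)
    (fun i d => (f i).1 \is d.-homog /\ (f i).2 \is d.-homog).
  by move=> i; case: (rf i).
have hp (P : pred I) (dg' : I -> nat) (p : I -> {mpoly k[N.+1]}) :
    (forall i, p i \is (dg' i).-homog) -> \prod_(i | P i) p i \is (\sum_(i | P i) dg' i)%N.-homog.
  move=> h; apply: (big_ind2 (fun (p : {mpoly k[N.+1]}) d => p \is d.-homog)) => //.
      exact: dhomog1.
    by move=> p1 d1 p2 d2 h1 h2; exact: dhomogM.
exists (\sum_i dg i)%N, (fun i => (f i).1 * \prod_(j | j != i) (f j).2); split.
- by apply: hp => i; case: (hdg i).
- by apply: (nonvanish_prod X_var) => i; case: (rf i).
- move=> i; have -> : (\sum_i dg i = dg i + \sum_(j | j != i) dg j)%N by rewrite (bigD1 i).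
  apply: dhomogM; first by case: (hdg i).
  by apply: hp => j; case: (hdg j).
by move=> i; rewrite (bigD1 i (P := xpredT)) //= -mulrA [_ * (f i).2]mulrC.
Qed.

Section Presentation.
Variables (n d : nat) (L : linear_system X n) (A : 'I_n.+1 -> {mpoly k[N.+1]})
  (D : {mpoly k[N.+1]}).
Hypotheses (A_homog : forall j, A j \is d.-homog) (D_homog : D \is d.-homog)
  (D_neq0 : ~ vanish_on X D)
  (A_sec : forall j, A j * (ls_sec L j).2 = (ls_sec L j).1 * D).

Let row_at (x : 'rV[k]_N.+1) : 'rV[k]_n.+1 := \row_j (A j).@[x 0].

Lemma presentation_neq0 : exists j, ~ vanish_on X (A j).
Proof.
have [j nj] := ls_neq0 L; exists j => Aj.
apply: (nonvanishM X_var nj D_neq0) => x Xx.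
by rewrite -A_sec mevalM Aj // mul0r.
Qed.

(** Near a point of the cover, the sections multiplied by the local equation of
    the divisor are all regular, and proportional to the A j, wherever the
    denominators and the local equation do not vanish. *)
Lemma ls_map_generic : exists p e, [/\ p \is e.-homog, ~ vanish_on X p &
  forall x, X x -> p.@[x 0] != 0 -> ls_map L x (row_at x)].
Proof.
have [_ [[x0 Xx0] _]] := X_var.
have [i ix0] := cd_covers (ls_div L) Xx0.
have [p1 [d1 [p1h p1x0 hp1]]] := zopen_form X_var (cd_open i) ix0.
have [j0 nA] := presentation_neq0.
have [[d2 [e1h e2h]] ne2] := cd_ratfun i.
have ne1 := cd_neq0 (i := i).
set eqn := cd_eqn i in e1h e2h ne2 ne1.
have rs j : ratfun X (ls_sec L j) := ls_ratfun L j.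
have [d3 [_ [Ph Pn _ _]]] := common_denominator rs.
set P := \prod_j _ in Ph Pn.
exists (p1 * A j0 * D * eqn.1 * eqn.2 * P), (d1 + d + d + d2 + d2 + d3)%N; split.
- by do !apply: dhomogM.
- do ![apply: nonvanishM => //]; exact: (value_nonvanish Xx0).
move=> x Xx; rewrite !mevalM !mulf_eq0 !negb_or.
case/andP => /andP[/andP[/andP[/andP[p1x Ax] Dx] e1x] e2x] Px.
have Px' j : (ls_sec L j).2.@[x 0] != 0.
  by move: Px; rewrite rmorph_prod /= => /prodf_neq0; apply.
exists i, ((eqn.1.@[x 0] / (D.@[x 0] * eqn.2.@[x 0])) *: row_at x); split.
- exact: hp1.
- move=> j; exists (frac_mul (ls_sec L j) eqn); split.
  + have [[d4 [s1 s2]] ns2] := rs j; split; last exact: nonvanishM.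
    by exists (d4 + d2)%N; split; apply: dhomogM.
  + by move=> y _; rewrite subrr meval0.
  + by rewrite mevalM mulf_neq0.
  have := congr1 (fun p => p.@[x 0]) (A_sec j); rewrite !mxE !mevalM => e.
  apply: (mulIf (Px' j)).
  have -> : eqn.1.@[x 0] / (D.@[x 0] * eqn.2.@[x 0]) * (A j).@[x 0] * (ls_sec L j).2.@[x 0]
     = eqn.1.@[x 0] / (D.@[x 0] * eqn.2.@[x 0]) * ((ls_sec L j).1.@[x 0] * D.@[x 0]).
    by rewrite -e mulrA.
  by field; rewrite ?Dx ?e2x ?Px'.
have c0 : eqn.1.@[x 0] / (D.@[x 0] * eqn.2.@[x 0]) != 0.
  by rewrite mulf_neq0 ?invr_eq0 ?mulf_neq0.
have r0 : row_at x != 0 by apply/rV0Pn; exists j0; rewrite mxE.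
split=> //; first by rewrite scaler_eq0 negb_or c0.
by exists (eqn.1.@[x 0] / (D.@[x 0] * eqn.2.@[x 0]))^-1; rewrite scalerA mulVf // scale1r.
Qed.

(** At every point of its domain the map of L is given by local representatives w
    that are proportional to A as functions on X, though A may vanish there.
    Identities between the A j therefore pass to all values of the map. *)
Lemma ls_map_values x y : ls_map L x y -> [/\ X x, y != 0 &
  exists (w : 'I_n.+1 -> {mpoly k[N.+1]}) u v (c : k),
  [/\ ~ vanish_on X u, c != 0, forall j, (w j).@[x 0] = c * y 0 j &
  forall z, X z -> forall j, u.@[z 0] * (w j).@[z 0] = v.@[z 0] * (A j).@[z 0]]].
Proof.
case=> i [v0 [ix hv [v00 y0 [c yc]]]].
have Xx : X x by have [Z _ h] := cd_open i; case/h: ix.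
split=> //; set eqn := cd_eqn i in hv.
have [g hg] := fin_all_exists hv.
have rg j : ratfun X (g j) by case: (hg j).
have [_ [w [_ _ _ wE]]] := common_denominator rg.
set P := \prod_j _ in wE.
have Px : P.@[x 0] != 0.
  by rewrite rmorph_prod; apply/prodf_neq0 => j _; case: (hg j).
have c0 : c != 0 by apply: contraNneq y0 => c0; rewrite yc c0 scale0r.
have [_ ne2] := cd_ratfun i.
exists w, (D * eqn.2), (eqn.1 * P), (P.@[x 0] / c); split.
- exact: nonvanishM.
- by rewrite mulf_neq0 ?invr_eq0.
- move=> j; have [_ _ gx ->] : [/\ ratfun X (g j), ratfun_eq X (frac_mul (ls_sec L j) eqn) (g j),
     (g j).2.@[x 0] != 0 & y 0 j = c * ((g j).1.@[x 0] / (g j).2.@[x 0])].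
    by have [? ? ? <-] := hg j; split=> //; rewrite yc mxE.
  have := congr1 (fun p => p.@[x 0]) (wE j); rewrite /= !mevalM => e.
  by apply: (mulIf gx); rewrite e; field; rewrite gx c0.
move=> z Xz j; apply/eqP; rewrite -subr_eq0 -!mevalM -mevalB; apply/eqP.
have [_ ns2] := ls_ratfun L j; have [_ geq _ _] := hg j; have [_ ng2] := rg j.
apply: (vanish_cancel X_var (nonvanishM X_var ns2 ng2) _ Xz) => t Xt.
have := congr1 (fun p => p.@[t 0]) (wE j); have := congr1 (fun p => p.@[t 0]) (A_sec j).
have := geq t Xt; rewrite /frac_mul /= !(mevalB, mevalM) => /eqP.
rewrite subr_eq0 => /eqP e1 e2 e3.
rewrite mulrBl.
have -> : D.@[t 0] * eqn.2.@[t 0] * (w j).@[t 0] * ((ls_sec L j).2.@[t 0] * (g j).2.@[t 0])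
  = ((w j).@[t 0] * (g j).2.@[t 0]) * (D.@[t 0] * eqn.2.@[t 0] * (ls_sec L j).2.@[t 0]) by ring.
rewrite e3.
have -> : eqn.1.@[t 0] * P.@[t 0] * (A j).@[t 0] * ((ls_sec L j).2.@[t 0] * (g j).2.@[t 0])
  = (A j).@[t 0] * (ls_sec L j).2.@[t 0] * (eqn.1.@[t 0] * P.@[t 0] * (g j).2.@[t 0]) by ring.
rewrite e2.
have -> : (ls_sec L j).1.@[t 0] * D.@[t 0] * (eqn.1.@[t 0] * P.@[t 0] * (g j).2.@[t 0])
  = ((ls_sec L j).1.@[t 0] * eqn.1.@[t 0] * (g j).2.@[t 0]) * (D.@[t 0] * P.@[t 0]) by ring.
by rewrite e1; ring.
Qed.

Lemma ls_map_proportional x y : ls_map L x y ->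
  exists c, forall j, (A j).@[x 0] = c * y 0 j.
Proof.
case/ls_map_values => Xx /rV0Pn[m ym] [w [u [v [c [nu c0 wy uw]]]]].
exists ((A m).@[x 0] / y 0 m) => j.
have : vanish_on X (A j * w m - A m * w j).
  apply: (vanish_cancel X_var nu) => z Xz; rewrite !(mevalM, mevalB).
  have -> : ((A j).@[z 0] * (w m).@[z 0] - (A m).@[z 0] * (w j).@[z 0]) * u.@[z 0]
    = (A j).@[z 0] * (u.@[z 0] * (w m).@[z 0]) - (A m).@[z 0] * (u.@[z 0] * (w j).@[z 0]) by ring.
  by rewrite !uw //; ring.
move/(_ x Xx); rewrite !(mevalB, mevalM) !wy => /eqP; rewrite subr_eq0 => /eqP e.
by apply: (mulIf ym); apply: (mulfI c0); rewrite mulrCA e; field.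
Qed.

(** Forms vanishing on the generic part of the image vanish on the whole of it. *)
Lemma ls_image_form x y p e : p \is e.-homog -> vanish_on X (msubst A p) ->
  ls_map L x y -> p.@[y 0] = 0.
Proof.
move=> pe pA /ls_map_values[Xx _ [w [u [v [c [nu c0 wy uw]]]]]].
have : vanish_on X (msubst w p).
  apply: (vanish_cancel X_var (nonvanish_exp X_var (d := e) nu)) => z Xz.
  rewrite mevalM rmorphXn /= msubst_eval mulrC -(dhomog_scale _ _ pe).
  have -> : p.@[fun i => u.@[z 0] * (w i).@[z 0]] = p.@[fun i => v.@[z 0] * (A i).@[z 0]].
    by apply: meval_eq => j; exact: uw.
  by rewrite (dhomog_scale _ _ pe) -(msubst_eval A) pA // mulr0.
move/(_ x Xx); rewrite msubst_eval (@meval_eq _ _ _ (fun j => c * y 0 j)) //.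
rewrite (dhomog_scale _ _ pe) => /eqP; rewrite mulf_eq0 => /orP[|/eqP //].
by rewrite expf_eq0 (negPf c0) andbF.
Qed.

Lemma ls_image_vanish p e : p \is e.-homog -> vanish_on X (msubst A p) ->
  vanish_on (ls_image L) p.
Proof.
move=> pe pA y; have := @zclosed_form k n p e pe => hc /(_ _ hc) [|//] z [x hz].
by have [_ z0 _] := ls_map_values hz; split=> //; exact: ls_image_form pe pA hz.
Qed.

Lemma ls_image_neq0 y : ls_image L y -> y != 0.
Proof.
move/(_ _ (@zclosed_pspace k n)); apply => z [x hz].
by have [] := ls_map_values hz.
Qed.

(** The birational inverse, evaluated on the generic representatives A, is
    proportional to x on a dense open set, hence everywhere. *)
Lemma embedding_generates : birational_embedding L -> generates d X A.
Proof.
case=> G [[g Gg] [i0 nG]] [[U Ud hU] _].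
have [j0 nA] := presentation_neq0.
apply: (@generates_of_inverse k N d X X_var _ A g G i0 j0) => //; last first.
  by move=> h; apply: nG; apply: ls_image_vanish (Gg i0) h.
move=> x Xx i j; apply/eqP; rewrite -subr_eq0; apply/eqP.
have [p [e [pe np hp]]] := dense_open_form X_var Ud.
pose q := msubst A (G i) * 'X_j - msubst A (G j) * 'X_i.
suff : vanish_on X q.
  by move/(_ x Xx); rewrite mevalB !mevalM !msubst_eval !mevalXU.
apply: (vanish_cancel X_var np) => {}x {}Xx; rewrite mevalM.
case: (eqVneq p.@[x 0] 0) => [->|px]; first by rewrite mulr0.
have [z [y xy [yim [G' [_ GG' [G'0 z0 [c zc]]]]]] [_ _ [c' zc']]] := hU x (hp x Xx px).
have [b AE] := ls_map_proportional xy.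
rewrite mevalB !mevalM !msubst_eval !mevalXU.
have GE l : (G l).@[fun i => (A i).@[x 0]] = b ^+ g * (G l).@[y 0].
  by rewrite -(dhomog_scale _ _ (Gg l)); exact: meval_eq.
have c'0 : c' != 0 by apply: contraNneq z0 => h; rewrite zc' h scale0r.
have xE l : x 0 l = c / c' * (G' l).@[y 0].
  have := congr1 (fun t : 'rV_N.+1 => t 0 l) zc'; rewrite zc !mxE => e'.
  by rewrite mulrAC e' mulrC mulKf.
have := GG' i j y yim; rewrite !GE !xE mevalB !mevalM => /eqP; rewrite subr_eq0 => /eqP e'.
have -> : b ^+ g * (G i).@[y 0] * (c / c' * (G' j).@[y 0]) =
  b ^+ g * (c / c') * ((G i).@[y 0] * (G' j).@[y 0]) by ring.
by rewrite e'; ring.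
Qed.

End Presentation.

(** Everything is checked on principal open sets, where A, B and one form F j0
    along B do not vanish, so that the maps are given by A, B and F themselves. *)
Lemma linked_cremona n d (L G : linear_system X n) (A B : 'I_n.+1 -> {mpoly k[N.+1]}) D E :
  (forall j, A j \is d.-homog) -> D \is d.-homog -> ~ vanish_on X D ->
  (forall j, A j * (ls_sec L j).2 = (ls_sec L j).1 * D) ->
  (forall j, B j \is d.-homog) -> E \is d.-homog -> ~ vanish_on X E ->
  (forall j, B j * (ls_sec G j).2 = (ls_sec G j).1 * E) ->
  linked X B A -> cremona_equivalent L G.
Proof.
move=> Ad Dd nD AL Bd Ed nE BG [F [F' [[[e Fe] [h [H [Hh nH FF]]] [M nM FM]]]]].
move=> [[e' Fe'] [h' [H' [Hh' nH' FF']]] [M' nM' FM']].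
have poly_neq0 (Y : 'I_n.+1 -> {mpoly k[N.+1]}) p : ~ vanish_on X (msubst Y p) -> p != 0.
  by move=> np; apply/eqP => p0; apply: np => x _; rewrite p0 msubst_eval meval0.
have [j0 nA] := presentation_neq0 nD AL; have [j1 nB] := presentation_neq0 nE BG.
have carried (Y Z : 'I_n.+1 -> {mpoly k[N.+1]}) (F1 : forms k n n) M1 j : ~ vanish_on X M1 ->
    (forall x, X x -> forall i, (F1 i).@[tuple_at Y x] = M1.@[x 0] * (Z i).@[x 0]) ->
    ~ vanish_on X (Z j) -> ~ vanish_on X (msubst Y (F1 j)).
  move=> n1 F1E nZ h1; apply: (nonvanishM X_var n1 nZ) => x Xx.
  by rewrite mevalM -F1E // -[RHS](h1 x Xx) msubst_eval.
have nF := carried _ _ _ _ _ nM FM nA; have nF' := carried _ _ _ _ _ nM' FM' nB.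
have rF : rational_map (@pspace k n) F.
  by split; [exists e | exists j0; apply: pspace_nonvanish; exact: poly_neq0 nF].
have rF' : rational_map (@pspace k n) F'.
  by split; [exists e' | exists j1; apply: pspace_nonvanish; exact: poly_neq0 nF'].
have [p [dp [ph np hp]]] := ls_map_generic Ad Dd nD AL.
have [q [dq [qh nq hq]]] := ls_map_generic Bd Ed nE BG.
have Fj0 : msubst B (F j0) \is (d * e).-homog by exact: msubst_homog.
have rowE (x : 'rV[k]_N.+1) (f : {mpoly k[n.+1]}) : f.@[(\row_j (B j).@[x 0]) 0] = f.@[tuple_at B x].
  by apply: meval_eq => j; rewrite mxE.
exists F; split.
- split=> //; exists F' => //; split.
    exact: (rmap_inverse rF rF' Hh (poly_neq0 _ _ nH) FF).
  exact: (rmap_inverse rF' rF Hh' (poly_neq0 _ _ nH') FF').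
- exists (fun y : 'rV[k]_n.+1 => ls_image G y /\ (F j0).@[y 0] != 0); last first.
    move=> y [yim Fy]; exists (\row_i (F i).@[y 0]).
    have y0 := ls_image_neq0 nE BG yim.
    by apply: rmap_value => //; apply/rV0Pn; exists j0; rewrite mxE.
  split.
    exists (fun y : 'rV[k]_n.+1 => y != 0 /\ (F j0).@[y 0] = 0); first exact: zclosed_form (Fe j0).
    move=> y; split=> -[yim Fy]; split=> //; first by case=> _ /eqP; rewrite (negPf Fy).
    apply/eqP => Fy0; apply: Fy; split=> //; exact: (ls_image_neq0 nE BG).
  move=> y yim Z Zc hZ; apply: (yim Z Zc) => z [x xz].
  have [_ z0 _] := ls_map_values nE BG xz.
  case: Zc hZ => S [Sh ZS] hZ; apply/ZS; split=> // f Sf.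
  have [df fd] := Sh f Sf; apply: (ls_image_form nE BG fd _ xz).
  apply: (vanish_cancel X_var (nonvanishM X_var nF nq)) => t Xt; rewrite !mevalM.
  case: (eqVneq (msubst B (F j0)).@[t 0] 0) => [->|Ft]; first by rewrite mul0r mulr0.
  case: (eqVneq q.@[t 0] 0) => [->|qt]; first by rewrite !mulr0.
  have /ZS[_ /(_ f Sf)] : Z (\row_j (B j).@[t 0]).
    apply: hZ; split; last by rewrite rowE -msubst_eval.
    by move=> Z' _; apply; exists t; exact: hq.
  by rewrite rowE msubst_eval -/(tuple_at B t) => ->; rewrite mul0r.
have dn : p * q * msubst B (F j0) \is (dp + dq + d * e).-homog by do !apply: dhomogM.
have nn : ~ vanish_on X (p * q * msubst B (F j0)) by do ![apply: nonvanishM => //].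
exists (fun x => X x /\ (p * q * msubst B (F j0)).@[x 0] != 0).
  exact: dense_open_nonvanish dn nn.
move=> x [Xx]; rewrite !mevalM !mulf_eq0 !negb_or msubst_eval => /andP[/andP[px qx] Fx].
have LA := hp x Xx px; have GB := hq x Xx qx.
exists (\row_j (A j).@[x 0]) => //; exists (\row_j (B j).@[x 0]) => //.
have [_ B0 _] := ls_map_values nE BG GB; have [_ A0 _] := ls_map_values nD AL LA.
split=> //; exists F; split=> //.
  by move=> i j y _; rewrite subrr meval0.
have FE : \row_i (F i).@[(\row_j (B j).@[x 0]) 0] = M.@[x 0] *: (\row_j (A j).@[x 0]).
  by apply/rowP => i; rewrite [LHS]mxE rowE FM // !mxE.
have Mx : M.@[x 0] != 0.
  by move: Fx; rewrite -/(tuple_at B x) FM // mulf_eq0 negb_or => /andP[].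
split=> //; first by rewrite FE scaler_eq0 negb_or Mx.
by exists (M.@[x 0])^-1; rewrite FE scalerA mulVf // scale1r.
Qed.

(** Both systems get one common denominator D.  Multiplying everything by a
    coordinate z not vanishing on X makes the common degree positive. *)
Lemma embeddings_cremona r n (L G : linear_system X n) :
  variety_dim X r -> (r.+2 <= n)%N ->
  birational_embedding L -> birational_embedding G -> cremona_equivalent L G.
Proof.
move=> X_dim rn embL embG.
pose s (i : 'I_n.+1 + 'I_n.+1) := match i with inl j => ls_sec L j | inr j => ls_sec G j end.
have rs i : ratfun X (s i) by case: i => j; exact: ls_ratfun.
have [d [C [Dd nD Cd CE]]] := common_denominator rs.
set D := \prod_i _ in Dd nD CE.
have [_ [[x0 Xx0] _]] := X_var; have /rV0Pn[i xi] := variety_neq0 X_var Xx0.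
pose z : {mpoly k[N.+1]} := 'X_i.
have nz : ~ vanish_on X z by apply: (value_nonvanish Xx0); rewrite mevalXU.
have zh : z \is 1.-homog by rewrite dhomogX /= mdeg1.
have zd p : p \is d.-homog -> p * z \is d.+1.-homog.
  by move=> pd; rewrite -[d.+1]addn1 dhomogM.
have zn := nonvanishM X_var nD nz.
have zE j : C j * z * (s j).2 = (s j).1 * (D * z) by rewrite mulrAC CE mulrA.
have gL := embedding_generates (fun j => zd _ (Cd (inl j))) zn (fun j => zE (inl j)) embL.
have gG := embedding_generates (fun j => zd _ (Cd (inr j))) zn (fun j => zE (inr j)) embG.
apply: (linked_cremona (fun j => zd _ (Cd (inl j))) (zd _ Dd) zn (fun j => zE (inl j))
  (fun j => zd _ (Cd (inr j))) (zd _ Dd) zn (fun j => zE (inr j))).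
apply: (generating_tuples_linked X_var X_dim _ rn _ _ gL gG) => // j; exact: zd.
Qed.

End LinearSystems.

Theorem theorem1 (k : closedFieldType) (N r n : nat) (X : pset k N)
  (X_var : projective_variety X) (X_dim : variety_dim X r) (n_ge : r + 2 <= n)
  (L G : linear_system X n)
  (L_emb : birational_embedding L) (G_emb : birational_embedding G) :
  cremona_equivalent L G.
Proof.
by apply: (embeddings_cremona X_var X_dim) => //; rewrite -addn2.
Qed.
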